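(* Let $\mathcal{G}=(\mathcal{V},\mathcal{E})$ be an undirected connected graph with $\mathcal{V}=\{1,\dots,N\}$, and consider the problem $\min_{(x_1,\dots,x_N)\in\mathbb{R}^n}\sum_{i=1}^N f_i(x_i)$ subject to $\sum_{i=1}^N A_i x_i=b$, where $f_i:\mathbb{R}^{n_i}\to\mathbb{R}$, $A_i\in\mathbb{R}^{m\times n_i}$, $b\in\mathbb{R}^m$, $n=\sum_{i=1}^N n_i$. Assume that: (i) there exists $\mu>0$ such that $x=(x_1,\dots,x_N)\mapsto\sum_{i=1}^N f_i(x_i)$ is $\mu$-strongly convex on $\mathbb{R}^n$, and there exists $c>0$ such that each $f_i$ is differentiable with $c$-Lipschitz continuous gradient $\nabla f_i$, for all $i\in\mathcal{V}$; (ii) the matrix $A=[A_1\ \cdots\ A_N]\in\mathbb{R}^{m\times n}$ has full row rank. Then, for all $\kappa,\rho>0$ and $\beta\in(0,1)$, there exists $\bar\gamma>0$ such that, for all $\gamma\in(0,\bar\gamma)$ and all initial conditions $(x_i^0,\lambda_i^0,z_i^0)\in\mathbb{R}^{n_i}\times\mathbb{R}^m\times\mathbb{R}^{2m\deg_i}$, $i\in\mathcal{V}$, the sequences $x^t=\mathrm{col}(x_1^t,\dots,x_N^t)$ and $\lambda^t=\mathrm{col}(\lambda_1^t,\dots,\lambda_N^t)$ generated by the distributed algorithm defined in the context satisfy $$\left\|\begin{bmatrix}x^t-x^\star\\ \lambda^t-\mathbf{1}\lambda^\star\end{bmatrix}\right\|\le a_1\exp(-a_2 t)\qquad\text{for all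 } t\in\mathbb{N},$$ for some $a_1,a_2>0$.
   Context: Notation: $\mathrm{col}(\cdot)$ denotes column stacking, $1_N\in\mathbb{R}^N$ is the all-ones vector, $I_m$ the $m\times m$ identity, $\otimes$ the Kronecker product, $\mathbf{1}:=1_N\otimes I_m\in\mathbb{R}^{Nm\times m}$. $\mathcal{N}_i=\{j\in\mathcal{V}:(i,j)\in\mathcal{E}\}$ is the set of neighbors of $i$ and $\deg_i=|\mathcal{N}_i|$. The pair $(x^\star,\lambda^\star)\in\mathbb{R}^n\times\mathbb{R}^m$ is the unique saddle point (minimum in $x$, maximum in $\bar\lambda$) of the standard Lagrangian $L(x,\bar\lambda)=\sum_{i=1}^N f_i(x_i)+\bar\lambda^\top\left(\sum_{i=1}^N A_ix_i-b\right)$; it exists and is unique under (i) and (ii), and $x^\star$ is the unique solution of the constrained problem. Distributed algorithm. Fix vectors $b_1,\dots,b_N\in\mathbb{R}^m$ with $\sum_{i=1}^N b_i=b$ (the local shares of the constraint vector). Each agent $i$ keeps variables $x_i^t\in\mathbb{R}^{n_i}$, $\lambda_i^t\in\mathbb{R}^m$, and $z_{ij}^t\in\mathbb{R}^{2m}$ for each $j\in\mathcal{N}_i$, with $z_i^t:=\mathrm{col}(z_{ij}^t)_{j\in\mathcal{N}_i}\in\mathbb{R}^{2m\deg_i}$. Parameters are $\kappa,\rho,\gamma>0$ and $\beta\in(0,1)$. For each $t=0,1,2,\dots$ and all $i\in\mathcal{V}$ simultaneously: $$\begin{bmatrix}\hat\alpha_i^{x,t}\\ \hat\alpha_i^{\lambda,t}\end{bmatrix}=\frac{1}{1+\rho\deg_i}\left(\begin{bmatrix}A_ix_i^t-b_i\\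 \lambda_i^t\end{bmatrix}+\sum_{j\in\mathcal{N}_i}z_{ij}^t\right),\qquad \hat\alpha_i^{x,t},\hat\alpha_i^{\lambda,t}\in\mathbb{R}^m,$$ $$x_i^{t+1}=x_i^t-\gamma\left(\nabla f_i(x_i^t)+A_i^\top\hat\alpha_i^{\lambda,t}\right),$$ $$\lambda_i^{t+1}=\lambda_i^t+\gamma\left(\kappa(\hat\alpha_i^{\lambda,t}-\lambda_i^t)+\hat\alpha_i^{x,t}\right),$$ $$z_{ij}^{t+1}=(1-\beta)z_{ij}^t+\beta\left(-z_{ji}^t+2\rho\begin{bmatrix}\hat\alpha_j^{x,t}\\ \hat\alpha_j^{\lambda,t}\end{bmatrix}\right)\qquad\forall j\in\mathcal{N}_i.$$ *)

(* Defs.v *)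
(* MathComp / MathComp-Analysis *)
From mathcomp Require Import all_boot all_order all_algebra.
From mathcomp Require Import all_classical all_reals all_analysis.

Set Implicit Arguments.
Unset Strict Implicit.
Unset Printing Implicit Defensive.

Import Order.TTheory GRing.Theory Num.Theory.
Import numFieldNormedType.Exports.

Local Open Scope ring_scope.

(* Euclidean norm; the library norm `|v| on matrices is the max norm. *)
Definition enorm (R : realType) (d : nat) (v : 'cV[R]_d) : R :=
  Num.sqrt (\sum_(k < d) v k 0 ^+ 2).

Definition grad (R : realType) (d : nat) (f : 'cV[R]_d -> R) (x : 'cV[R]_d) :
  'cV[R]_d := \col_k 'D_(delta_mx k 0) f x.

Definition strongly_convex (R : realType) (d : nat) (mu : R)
    (F : 'cV[R]_d -> R) : Prop :=
  forall (x y : 'cV[R]_d) (t : R), 0 <= t <= 1 ->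
    F (t *: x + (1 - t) *: y) <=
      t * F x + (1 - t) * F y - mu / 2 * t * (1 - t) * enorm (x - y) ^+ 2.

Definition elipschitz (R : realType) (d d' : nat) (c : R)
    (g : 'cV[R]_d -> 'cV[R]_d') : Prop :=
  forall x y : 'cV[R]_d, enorm (g x - g y) <= c * enorm (x - y).

Section Problem.
Variables (R : realType) (N m : nat) (n : 'I_N -> nat).

(* A vector of R^n with n = n_1 + ... + n_N is x : 'cV_(\sum_i n i); its block
   x_i is submxcol x i. *)

Definition total_cost (f : forall i, 'cV[R]_(n i) -> R)
    (x : 'cV[R]_(\sum_i n i)) : R :=
  \sum_i f i (submxcol x i).

Definition lagrangian (f : forall i, 'cV[R]_(n i) -> R)
    (A : forall i, 'M[R]_(m, n i)) (b : 'cV[R]_m)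
    (x : 'cV[R]_(\sum_i n i)) (l : 'cV[R]_m) : R :=
  total_cost f x + (l^T *m (\sum_i A i *m submxcol x i - b)) 0 0.

Definition saddle_point (f : forall i, 'cV[R]_(n i) -> R)
    (A : forall i, 'M[R]_(m, n i)) (b : 'cV[R]_m)
    (xs : 'cV[R]_(\sum_i n i)) (ls : 'cV[R]_m) : Prop :=
  (forall x, lagrangian f A b xs ls <= lagrangian f A b x ls) /\
  (forall l, lagrangian f A b xs l <= lagrangian f A b xs ls).

Definition neighbors (e : rel 'I_N) (i : 'I_N) : {set 'I_N} :=
  [set j | e i j].

Definition deg (e : rel 'I_N) (i : 'I_N) : nat := #|neighbors e i|.

(* Only the entries st_z i j with j a neighbor of i are part of the algorithm;
   for symmetric e the others are never read and are left unchanged by step. *)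
Record state := State {
  st_x : forall i, 'cV[R]_(n i);
  st_lambda : 'I_N -> 'cV[R]_m;
  st_z : 'I_N -> 'I_N -> 'cV[R]_(m + m) }.

Arguments st_x s i : clear implicits.

Section Algorithm.
Variables (e : rel 'I_N) (f : forall i, 'cV[R]_(n i) -> R).
Variables (A : forall i, 'M[R]_(m, n i)) (bs : 'I_N -> 'cV[R]_m).
Variables (kappa rho beta gamma : R).
Arguments f : clear implicits.
Arguments A : clear implicits.

Definition alpha_hat (s : state) (i : 'I_N) : 'cV[R]_(m + m) :=
  (1 + rho * (deg e i)%:R)^-1 *:
    (col_mx (A i *m st_x s i - bs i) (st_lambda s i)
     + \sum_(j in neighbors e i) st_z s i j).

Definition alpha_x (s : state) (i : 'I_N) : 'cV[R]_m :=
  usubmx (alpha_hat s i).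

Definition alpha_lambda (s : state) (i : 'I_N) : 'cV[R]_m :=
  dsubmx (alpha_hat s i).

Definition step (s : state) : state := {|
  st_x := fun i =>
    st_x s i
    - gamma *: (grad (f i) (st_x s i) + (A i)^T *m alpha_lambda s i);
  st_lambda := fun i =>
    st_lambda s i
    + gamma *: (kappa *: (alpha_lambda s i - st_lambda s i) + alpha_x s i);
  st_z := fun i j =>
    if j \in neighbors e i then
      (1 - beta) *: st_z s i j
      + beta *: (- st_z s j i + (2 * rho) *: alpha_hat s j)
    else st_z s i j |}.

Definition run (s0 : state) (t : nat) : state := iter t step s0.

End Algorithm.

Definition stack_x (s : state) : 'cV[R]_(\sum_i n i) := \mxcol_i st_x s i.

Definition stack_lambda (s : state) : 'cV[R]_(\sum_(i < N) m) :=
  \mxcol_(i < N) st_lambda s i.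

(* 1_N (x) I_m : the column of N identity blocks. *)
Definition ones_kron : 'M[R]_(\sum_(i < N) m, m) := \mxcol_(i < N) 1%:M.

End Problem.

Arguments st_x {R N m n} s i.
Arguments ones_kron {R} N m.

(* Main.v *)
(* For frozen node inputs v_i = col(A_i x_i - b_i, lambda_i), the edge variables
   follow a relaxed reflection z+ = (1 - beta) z + beta T z with T affine and
   nonexpansive. Its fixed points are not unique (circulations along cycles of
   the graph are invariant and invisible to alpha), so the fast variable is not
   a distance to an equilibrium but the residual r = z - T z. It obeys
   z+ = z - beta r, its antisymmetric part is the gradient of 2 rho alpha, and
   on such fields the linear part of the relaxed reflection contracts strictly
   when the graph is connected. Moreover |alpha_i - mean v| = O(|r|).

   With alpha replaced by mean v, (x, lambda) follows an Euler step of size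
   gamma of a primal-dual gradient flow, for which
   V = |x - xs|^2 + sum_i |lambda_i - ls|^2 + 2 eps <mean lambda - ls, A (x - xs)>
   is a strict Lyapunov function. As r changes by O(gamma) per step because of
   the motion of v, V + |r|^2 decreases geometrically for small gamma.

   The saddle point is obtained from the optimality conditions
   grad F x + A^T lambda = 0, A x = b. *)
From HB Require Import structures.
Require Import Defs.
From mathcomp Require Import all_boot all_order all_algebra.
From mathcomp Require Import all_classical all_reals all_analysis.
From mathcomp Require Import ring lra.

Set Implicit Arguments.
Unset Strict Implicit.
Unset Printing Implicit Defensive.

Import Order.TTheory GRing.Theory Num.Theory.
Import numFieldNormedType.Exports.

Local Open Scope ring_scope.

(** * Euclidean inner product, Young and Cauchy-Schwarz inequalities, norm bounds *)

Definition dot (R : realType) (d : nat) (u v : 'cV[R]_d) : R :=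
  \sum_k u k 0 * v k 0.

Notation sq u := (dot u u).

Section Dot.
Variables (R : realType).

Section Fixed.
Variable d : nat.
Implicit Types u v w : 'cV[R]_d.

Lemma dotE u v : dot u v = (u^T *m v) 0 0.
Proof. by rewrite mxE; apply: eq_bigr => k _; rewrite mxE. Qed.

Lemma dotC u v : dot u v = dot v u.
Proof. by apply: eq_bigr => k _; rewrite mulrC. Qed.

Lemma dotDl u v w : dot (u + v) w = dot u w + dot v w.
Proof. by rewrite -big_split; apply: eq_bigr => k _; rewrite mxE mulrDl. Qed.

Lemma dotZl a u v : dot (a *: u) v = a * dot u v.
Proof. by rewrite /dot mulr_sumr; apply: eq_bigr => k _; rewrite mxE mulrA. Qed.

Lemma dotNl u v : dot (- u) v = - dot u v.
Proof. by rewrite -scaleN1r dotZl mulN1r. Qed.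

Lemma dot0l v : dot 0 v = 0.
Proof. by rewrite -(scale0r 0) dotZl mul0r. Qed.

Lemma dotDr u v w : dot u (v + w) = dot u v + dot u w.
Proof. by rewrite dotC dotDl !(dotC _ u). Qed.

Lemma dotZr a u v : dot u (a *: v) = a * dot u v.
Proof. by rewrite dotC dotZl dotC. Qed.

Lemma dotNr u v : dot u (- v) = - dot u v.
Proof. by rewrite dotC dotNl dotC. Qed.

Definition dot_bilin := (dotDl, dotDr, dotNl, dotNr, dotZl, dotZr).

Lemma dot_suml (I : Type) (r : seq I) (P : pred I) (F : I -> 'cV[R]_d) v :
  dot (\sum_(i <- r | P i) F i) v = \sum_(i <- r | P i) dot (F i) v.
Proof.
exact: (big_morph (fun u => dot u v) (fun x y => dotDl x y v) (dot0l v)).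
Qed.

Lemma dot_sumr (I : Type) (r : seq I) (P : pred I) (F : I -> 'cV[R]_d) v :
  dot v (\sum_(i <- r | P i) F i) = \sum_(i <- r | P i) dot v (F i).
Proof. by rewrite dotC dot_suml; under eq_bigr do rewrite dotC. Qed.

Lemma sq_ge0 u : 0 <= sq u.
Proof. by apply: sumr_ge0 => k _; rewrite -expr2 sqr_ge0. Qed.

Lemma sq_eq0 u : (sq u == 0) = (u == 0).
Proof.
apply/eqP/eqP => [|->]; last exact: dot0l.
move/eqP; rewrite psumr_eq0 => [/allP h|k _]; last by rewrite -expr2 sqr_ge0.
apply/matrixP => k j; rewrite ord1 mxE; apply/eqP.
by have := h k (mem_index_enum k); rewrite /= -expr2 sqrf_eq0.
Qed.

Lemma sqZ a u : sq (a *: u) = a ^+ 2 * sq u.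
Proof. by rewrite dotZl dotZr mulrA expr2. Qed.

Lemma sqN u : sq (- u) = sq u.
Proof. by rewrite dotNl dotNr opprK. Qed.

Lemma sqD u v : sq (u + v) = sq u + 2 * dot u v + sq v.
Proof. by rewrite !dot_bilin (dotC v u); ring. Qed.

Lemma sqB u v : sq (u - v) = sq u - 2 * dot u v + sq v.
Proof. by rewrite !dot_bilin (dotC v u); ring. Qed.

Lemma young s u v : 0 < s -> 2 * dot u v <= s * sq u + s^-1 * sq v.
Proof.
move=> s0; have s_neq0 : s != 0 by rewrite gt_eqF.
have := sq_ge0 (s *: u - v); rewrite sqB sqZ dotZl => h.
rewrite -subr_ge0; have -> : s * sq u + s^-1 * sq v - 2 * dot u v
   = s^-1 * (s ^+ 2 * sq u - 2 * (s * dot u v) + sq v) by field.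
by rewrite mulr_ge0 // invr_ge0 ltW.
Qed.

Lemma youngN s u v : 0 < s -> - (2 * dot u v) <= s * sq u + s^-1 * sq v.
Proof. by move=> /(young u (- v)); rewrite dotNr sqN mulrN. Qed.

Lemma sqD_le u v : sq (u + v) <= 2 * (sq u + sq v).
Proof. by have := sq_ge0 (u - v); rewrite sqB sqD; lra. Qed.

Lemma sqB_le u v : sq (u - v) <= 2 * (sq u + sq v).
Proof. by rewrite -(sqN v) sqD_le. Qed.

Lemma cauchy_schwarz u v : dot u v ^+ 2 <= sq u * sq v.
Proof.
have [/eqP u0|u_neq0] := eqVneq (sq u) 0.
  by rewrite sq_eq0 in u0; rewrite (eqP u0) !dot0l mul0r expr0n.
have u0 : 0 < sq u by rewrite lt_def u_neq0 sq_ge0.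
have := sq_ge0 (sq u *: v - dot u v *: u).
rewrite sqB !sqZ dotZl dotZr (dotC v u).
rewrite -(pmulr_rge0 _ u0) => h; rewrite -(ler_pM2l u0) -(ler_pM2l u0).
by move: h; rewrite !expr2; lra.
Qed.

(** Each term [2 * dot (F i) (F j)] is at most [sq (F i) + sq (F j)]. The count of [P] is coarsened
    to [#|I|], so the constant does not depend on [P]. *)
Lemma sq_sum_le (I : finType) (P : pred I) (F : I -> 'cV[R]_d) :
  sq (\sum_(i | P i) F i) <= #|I|%:R * \sum_(i | P i) sq (F i).
Proof.
rewrite dot_suml; under eq_bigr do rewrite dot_sumr.
set S := \sum_(i | P i) sq (F i); pose k : R := #|[pred i | P i]|%:R.
have S0 : 0 <= S by apply: sumr_ge0 => i _; apply: sq_ge0.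
have kI : k <= #|I|%:R by rewrite ler_nat max_card.
have cst x : \sum_(i | P i) x = k * x by rewrite sumr_const mulr_natl.
apply: (@le_trans _ _ (\sum_(i | P i) (k * sq (F i) + S) / 2)).
  apply: ler_sum => i _; rewrite -cst -big_split mulr_suml.
  apply: ler_sum => j _ /=.
  by have := sq_ge0 (F i - F j); rewrite sqB; lra.
rewrite -mulr_suml big_split /= cst -mulr_sumr -/S.
have := ler_wpM2r S0 kI.
by lra.
Qed.

End Fixed.

Lemma dot_mulmxr d d' (M : 'M[R]_(d', d)) u v :
  dot u (M *m v) = dot (M^T *m u) v.
Proof. by rewrite !dotE trmx_mul trmxK mulmxA. Qed.

Lemma sq_mulmx_le d d' (M : 'M[R]_(d', d)) :
  exists2 C, 0 < C & forall v, sq (M *m v) <= C * sq v.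
Proof.
have F0 : 0 <= \sum_i sq (row i M)^T by apply: sumr_ge0 => i _; apply: sq_ge0.
(* The squared Frobenius norm of [M]; the added 1 keeps the constant positive when [M = 0]. *)
exists (1 + \sum_i sq (row i M)^T) => [|v]; first by lra.
apply: (@le_trans _ _ ((\sum_i sq (row i M)^T) * sq v)); last first.
  by apply: ler_wpM2r; [exact: sq_ge0|lra].
rewrite [X in X <= _]/dot mulr_suml; apply: ler_sum => i _.
rewrite -expr2 (_ : (M *m v) i 0 = dot (row i M)^T v) ?cauchy_schwarz //.
by rewrite mxE; apply: eq_bigr => k _; rewrite !mxE.
Qed.

Lemma enorm_sqr d (v : 'cV[R]_d) : enorm v ^+ 2 = sq v.
Proof.
rewrite /enorm sqr_sqrtr; first by apply: eq_bigr => k _; rewrite expr2.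
by apply: sumr_ge0 => k _; rewrite sqr_ge0.
Qed.

Lemma sq_col_mx d d' (u : 'cV[R]_d) (v : 'cV[R]_d') :
  sq (col_mx u v) = sq u + sq v.
Proof.
rewrite /dot big_split_ord /=; congr (_ + _); apply: eq_bigr => i _.
  by rewrite col_mxEu.
by rewrite col_mxEd.
Qed.

Lemma dot_mxcol N (n : 'I_N -> nat) (u v : forall i, 'cV[R]_(n i)) :
  dot (\mxcol_i u i) (\mxcol_i v i) = \sum_i dot (u i) (v i).
Proof.
rewrite dotE tr_mxcol mul_mxrow_mxcol summxE.
by apply: eq_bigr => i _; rewrite dotE.
Qed.

End Dot.

(** The last term is the gain of averaging: it makes a relaxed nonexpansive map lose energy wherever
    it moves a point. *)
Lemma sqD_relax (R : realType) d (b : R) (u v : 'cV[R]_d) :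
  sq ((1 - b) *: u + b *: v) =
  (1 - b) * sq u + b * sq v - b * (1 - b) * sq (u - v).
Proof. by rewrite !sqD !sqZ sqN dotZl dotZr dotNr; ring. Qed.

Lemma uniform_bound (R : realType) (I : finType) (T : Type)
    (F : I -> T -> R) (G : T -> R) :
  (forall x, 0 <= G x) ->
  (forall i, exists2 C, 0 < C & forall x, F i x <= C * G x) ->
  exists2 C, 0 < C & forall x i, F i x <= C * G x.
Proof.
move=> G0 /(_ _)/cid2-/all_sig2[C C0 FC].
have S0 : 0 <= \sum_i C i by apply: sumr_ge0 => i _; apply: ltW.
exists (1 + \sum_i C i) => [|x i]; first by lra.
apply: le_trans (FC i x) _; rewrite ler_wpM2r // (bigD1 i) //=.
have : 0 <= \sum_(j | j != i) C j by apply: sumr_ge0 => j _; apply: ltW.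
by lra.
Qed.

(** * Edge sums over the graph and the energy balance of the reflection *)

Section Network.
Variables (R : realType) (N D : nat) (e : rel 'I_N) (rho : R).
Hypotheses (e_sym : symmetric e) (e_conn : forall i j, connect e i j).
Hypothesis rho_gt0 : 0 < rho.

Implicit Types (q : 'I_N -> 'I_N -> 'cV[R]_D) (g : 'I_N -> 'cV[R]_D).

Definition esum (F : 'I_N -> 'I_N -> R) : R := \sum_i \sum_(j | e i j) F i j.

Definition energy q : R := esum (fun i j => sq (q i j)).

Definition agg q (i : 'I_N) : 'cV[R]_D :=
  (1 + rho * (deg e i)%:R)^-1 *: \sum_(j | e i j) q i j.

(** Linear part of the map [T] of the overview; [agg] is likewise the linear part of [alpha_hat] in
    the edge variables. *)
Definition reflect_z q (i j : 'I_N) : 'cV[R]_D :=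
  - q j i + (2 * rho) *: agg q j.

Lemma esumC F : esum F = esum (fun i j => F j i).
Proof.
rewrite /esum (exchange_big_dep predT) //=.
by apply: eq_bigr => j _; apply: eq_bigl => i; rewrite e_sym.
Qed.

Lemma eq_esum F G : (forall i j, e i j -> F i j = G i j) -> esum F = esum G.
Proof. by move=> FG; apply: eq_bigr => i _; apply: eq_bigr => j /FG. Qed.

Lemma ler_esum F G : (forall i j, e i j -> F i j <= G i j) -> esum F <= esum G.
Proof. by move=> FG; apply: ler_sum => i _; apply: ler_sum => j /FG. Qed.

Lemma esumD F G : esum (fun i j => F i j + G i j) = esum F + esum G.
Proof. by rewrite -big_split; apply: eq_bigr => i _; rewrite -big_split. Qed.

Lemma esumZ a F : esum (fun i j => a * F i j) = a * esum F.
Proof. by rewrite mulr_sumr; apply: eq_bigr => i _; rewrite mulr_sumr. Qed.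

Lemma esum_node F : esum (fun i _ => F i) = \sum_i (deg e i)%:R * F i.
Proof.
apply: eq_bigr => i _; rewrite sumr_const mulr_natl; congr (_ *+ _).
by apply: eq_card => j; rewrite /neighbors !inE.
Qed.

Lemma esum_ge0 F : (forall i j, e i j -> 0 <= F i j) -> 0 <= esum F.
Proof. by move=> F0; apply: sumr_ge0 => i _; apply: sumr_ge0 => j /F0. Qed.

Lemma energy_ge0 q : 0 <= energy q.
Proof. by apply: esum_ge0 => i j _; apply: sq_ge0. Qed.

Lemma sumsq_ge0 (I : finType) d (F : I -> 'cV[R]_d) : 0 <= \sum_i sq (F i).
Proof. by apply: sumr_ge0 => i _; apply: sq_ge0. Qed.

Lemma weight_gt0 i : 0 < 1 + rho * (deg e i)%:R.
Proof.
by have := mulr_ge0 (ltW rho_gt0) (ler0n R (deg e i)); lra.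
Qed.

Lemma aggE q i :
  \sum_(j | e i j) q i j = (1 + rho * (deg e i)%:R) *: agg q i.
Proof. by rewrite scalerA divff ?scale1r // gt_eqF // weight_gt0. Qed.

Lemma deg_le i : (deg e i)%:R <= N%:R :> R.
Proof.
by rewrite ler_nat; have := max_card [in neighbors e i]; rewrite card_ord.
Qed.

(** After reversing the edges, node [i] contributes [- 4 * rho * (1 + rho * deg_i)] from the cross
    terms and [4 * rho ^+ 2 * deg_i] from the squares, times [sq (agg q i)]; the degrees cancel. *)
Lemma energy_reflect q :
  energy (reflect_z q) = energy q - 4 * rho * \sum_i sq (agg q i).
Proof.
have -> : energy (reflect_z q) = esum (fun i j => sq (q i j) +
    ((- 4 * rho) * dot (q i j) (agg q i) + 4 * rho ^+ 2 * sq (agg q i))).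
  rewrite /energy esumC; apply: eq_esum => i j _.
  by rewrite /reflect_z addrC sqB sqZ dotZl (dotC (agg q i)); ring.
rewrite esumD; congr (_ + _); rewrite esumD !esumZ.
rewrite (esum_node (fun i => sq (agg q i))) /esum.
under eq_bigr do rewrite -dot_suml aggE dotZl.
rewrite !mulr_sumr -big_split -sumrN; apply: eq_bigr => i _ /=.
by ring.
Qed.

Lemma energy_relax b q :
  energy (fun i j => (1 - b) *: q i j + b *: reflect_z q i j) =
  energy q - 4 * rho * b * \sum_i sq (agg q i)
  - b * (1 - b) * energy (fun i j => q i j - reflect_z q i j).
Proof.
have -> : energy (fun i j => (1 - b) *: q i j + b *: reflect_z q i j) =
  (1 - b) * energy q + b * energy (reflect_z q)
  + (- (b * (1 - b))) * energy (fun i j => q i j - reflect_z q i j).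
  rewrite /energy -!esumZ -!esumD.
  by apply: eq_esum => i j _; rewrite sqD_relax; ring.
by rewrite energy_reflect; ring.
Qed.

(** A Poincare inequality on the graph: differences are chained along a connecting path, at the cost
    of [2 + 2 * C] per edge, and the constants of the finitely many pairs are merged. *)
Lemma disagreement_le : exists2 C, 0 < C & forall g i j,
  sq (g i - g j) <= C * energy (fun k l => g k - g l).
Proof.
have path_le i : forall p : seq 'I_N, path e i p -> exists2 C, 0 < C &
    forall g, sq (g i - g (last i p)) <= C * energy (fun k l => g k - g l).
  move=> p; elim: p i => [|k p IH] i /=.
    by exists 1 => // g; rewrite subrr dot0l mul1r energy_ge0.
  case/andP=> eik /IH[C C0 HC]; exists (2 + 2 * C) => [|g]; first by lra.
  have -> : g i - g (last k p) = (g i - g k) + (g k - g (last k p)).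
    by rewrite addrA subrK.
  apply: le_trans (sqD_le _ _) _; have := HC g.
  suff : sq (g i - g k) <= energy (fun k l => g k - g l) by lra.
  rewrite /energy /esum (bigD1 i) //= (bigD1 k) //= -addrA lerDl addr_ge0 //.
    by apply: sumr_ge0 => j _; apply: sq_ge0.
  by apply: sumr_ge0 => j _; apply: sumr_ge0 => l _; apply: sq_ge0.
have [|p|C C0 HC] := @uniform_bound R ('I_N * 'I_N)%type ('I_N -> 'cV[R]_D)
  (fun p g => sq (g p.1 - g p.2)) (fun g => energy (fun k l => g k - g l)).
- by move=> g; apply: energy_ge0.
- by have /connectP[s sp ->] := e_conn p.1 p.2; apply: path_le.
by exists C => // g i j; apply: (HC g (i, j)).
Qed.

End Network.

(** * Contraction of the edge residual and tracking of the mean input *)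

Section Consensus.
Variables (R : realType) (N D : nat) (e : rel 'I_N) (rho : R).
Hypotheses (e_sym : symmetric e) (e_conn : forall i j, connect e i j).
Hypothesis rho_gt0 : 0 < rho.

Implicit Types (q z : 'I_N -> 'I_N -> 'cV[R]_D) (g v : 'I_N -> 'cV[R]_D).

Local Notation esum := (esum e).
Local Notation energy := (energy e).
Local Notation agg := (agg e rho).
Local Notation reflect_z := (reflect_z e rho).
Local Notation weight i := (1 + rho * (deg e i)%:R).

Lemma weight_le i : weight i <= 1 + rho * N%:R.
Proof. by rewrite lerD2l ler_pM2l // deg_le. Qed.

Lemma esum_node_le (F : 'I_N -> R) : (forall i, 0 <= F i) ->
  esum (fun i _ => F i) <= N%:R * \sum_i F i.
Proof.
move=> F0; rewrite (esum_node e F) mulr_sumr; apply: ler_sum => i _.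
by rewrite ler_wpM2r // deg_le.
Qed.

(* Antisymmetric flows with zero divergence are fixed by the reflection; the
   hypothesis excludes them, since gradient flows are orthogonal to them. *)
Lemma energy_coercive : exists2 C, 0 < C & forall q g,
  (forall i j, e i j -> q i j - q j i = g i - g j) ->
  energy q <= C * (\sum_i sq (agg q i)
                   + energy (fun i j => q i j - reflect_z q i j)).
Proof.
have [C C0 disC] := @disagreement_le R N D e e_conn.
have N0 : 0 <= N%:R :> R := ler0n _ _.
pose W := 1 + rho * N%:R; have W1 : 1 <= W by rewrite lerDl mulr_ge0 // ltW.
(* [ti^-1] is the Young weight in [B1] and [B2], sized so that their multiples of [G] add up to at
   most [G / 2] ([B3]). *)
pose ti := 2 * C * (N%:R + N%:R * N%:R + 1).
have NN0 : 0 <= N%:R * N%:R :> R by rewrite mulr_ge0.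
have ti0 : 0 < ti by rewrite !mulr_gt0 //; lra.
pose K := 4 * ti * W ^+ 2 + (ti + 1) * (8 * rho ^+ 2 * N%:R + 2).
have rr0 : 0 <= rho ^+ 2 by rewrite sqr_ge0.
have rN0 : 0 <= 8 * rho ^+ 2 * N%:R by rewrite mulr_ge0 // mulr_ge0.
have W20 : 0 <= W ^+ 2 by rewrite sqr_ge0.
have tiW : 0 <= 4 * ti * W ^+ 2 by rewrite mulr_ge0 // mulr_ge0 // ltW.
have K0 : 0 < K.
  suff : 0 < (ti + 1) * (8 * rho ^+ 2 * N%:R + 2) by rewrite /K; lra.
  by rewrite mulr_gt0 //; lra.
exists K => // q g qg.
set S := \sum_i _; set Er := energy (fun i j => _ - _).
have S0 : 0 <= S := sumsq_ge0 _.
have Er0 : 0 <= Er := energy_ge0 _ _.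
(* A reference node [i0] is needed to normalise the potential; without nodes every energy is an
   empty sum. *)
case: (pickP (xpredT : pred 'I_N)) => [i0 _|no]; last first.
  have -> : energy q = 0 by apply: big_pred0; exact: no.
  by apply: mulr_ge0; [exact: ltW|exact: addr_ge0].
(* On edges [2 *: q i j = s i j + (g i - g j)]: the symmetric part [s] is controlled by the residual
   and [agg], the gradient part by summation by parts. *)
pose h i := g i - g i0; pose s i j := q i j + q j i.
have [G defG] : {G | G = energy (fun k l => g k - g l)} by eexists.
have hG i : sq (h i) <= C * G by rewrite defG; apply: disC.
have G0 : 0 <= G by rewrite defG energy_ge0.
have Es : energy s <= 2 * Er + 8 * rho ^+ 2 * N%:R * S.
  apply: (@le_trans _ _
    (2 * Er + 8 * rho ^+ 2 * esum (fun i j => sq (agg q j)))).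
    rewrite -!esumZ -esumD; apply: ler_esum => i j _.
    have -> : s i j = (q i j - reflect_z q i j) + (2 * rho) *: agg q j.
      by rewrite /reflect_z opprD opprK addrA subrK.
    by apply: le_trans (sqD_le _ _) _; rewrite sqZ; lra.
  rewrite esumC // lerD2l -(mulrA (8 * rho ^+ 2)).
  apply: ler_wpM2l; first exact: mulr_ge0.
  by apply: esum_node_le => i; apply: sq_ge0.
(* Discrete integration by parts: the first sum sees [q] only through its node sums, that is
   [agg q], and the second only through [s]. *)
have GE : G = 4 * esum (fun i j => dot (h i) (q i j))
              + (-2) * esum (fun i j => dot (h j) (s i j)).
  have -> : G = esum (fun i j => dot (h i) (q i j))
     + esum (fun i j => dot (h j) (q j i))
     + (-1) * esum (fun i j => dot (h i) (q j i))
     + (-1) * esum (fun i j => dot (h j) (q i j)).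
    rewrite defG -!esumZ -!esumD; apply: eq_esum => i j eij.
    rewrite -{2}(qg _ _ eij).
    have -> : g i - g j = h i - h j by rewrite /h opprB addrA subrK.
    by rewrite !dot_bilin; ring.
  rewrite (esumC e_sym (fun i j => dot (h j) (q j i))).
  rewrite (esumC e_sym (fun i j => dot (h i) (q j i))).
  have -> : esum (fun i j => dot (h j) (s i j)) =
     esum (fun i j => dot (h j) (q i j)) + esum (fun i j => dot (h i) (q i j)).
    rewrite [X in _ + X]esumC // -esumD; apply: eq_esum => i j _.
    by rewrite /s dotDr.
  by ring.
have B1 : 4 * esum (fun i j => dot (h i) (q i j)) <=
   ti^-1 * (C * N%:R * G) + 4 * ti * W ^+ 2 * S.
  rewrite /esum; under eq_bigr do rewrite -dot_sumr (aggE e rho_gt0) dotZr.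
  have -> : C * N%:R * G = \sum_(i < N) C * G.
    by rewrite sumr_const card_ord -mulr_natl; ring.
  rewrite mulr_sumr [ti^-1 * _]mulr_sumr [_ * S]mulr_sumr -big_split.
  apply: ler_sum => i _ /=.
  have := young (h i) ((2 * weight i) *: agg q i) (_ : 0 < ti^-1).
  rewrite invr_gt0 => /(_ ti0); rewrite invrK sqZ dotZr => H.
  have H1 := ler_wpM2l (ltW (_ : 0 < ti^-1)) (hG i).
  rewrite invr_gt0 in H1; have {}H1 := H1 ti0.
  have H2 : ti * ((2 * weight i) ^+ 2 * sq (agg q i)) <=
            ti * (4 * W ^+ 2 * sq (agg q i)).
    rewrite ler_wpM2l ?(ltW ti0) // ler_wpM2r ?sq_ge0 //.
    rewrite exprMn (_ : 2 ^+ 2 = 4 :> R); last by rewrite expr2 -natrM.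
    rewrite ler_wpM2l // lerXn2r ?nnegrE ?weight_le //.
      by rewrite ltW // weight_gt0.
    exact: le_trans W1.
  by lra.
have B2 : (-2) * esum (fun i j => dot (h j) (s i j)) <=
    ti^-1 * (C * (N%:R * N%:R) * G) + ti * energy s.
  apply: (@le_trans _ _ (ti^-1 * (C * esum (fun _ _ => G)) + ti * energy s)).
    rewrite -!esumZ -esumD; apply: ler_esum => i j _.
    have := youngN (h j) (s i j) (_ : 0 < ti^-1).
    rewrite invr_gt0 => /(_ ti0); rewrite invrK => H.
    have H1 := ler_wpM2l (ltW (_ : 0 < ti^-1)) (hG j).
    rewrite invr_gt0 in H1; have {}H1 := H1 ti0.
    by lra.
  rewrite lerD2r ler_pM2l ?invr_gt0 // -mulrA ler_pM2l //.
  apply: le_trans (esum_node_le (fun=> G0)) _.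
  by rewrite sumr_const card_ord -[G *+ N]mulr_natl mulrA.
have B3 : ti^-1 * (C * (N%:R + N%:R * N%:R) * G) <= G / 2.
  rewrite ler_pdivrMl // /ti.
  have : 0 <= C * G by rewrite mulr_ge0 // ltW.
  by lra.
have GB : G <= 2 * (4 * ti * W ^+ 2 * S + ti * energy s) by lra.
have qB : 4 * energy q <= 2 * energy s + 2 * G.
  rewrite defG -!esumZ -esumD; apply: ler_esum => i j eij.
  have -> : 4 * sq (q i j) = sq (2 *: q i j) by rewrite sqZ; ring.
  have -> : 2 *: q i j = s i j + (g i - g j).
    by rewrite -qg // /s addrACA subrr addr0 scaler_nat mulr2n.
  by rewrite -mulrDr sqD_le.
have tEs := ler_wpM2l (ltW (_ : 0 < ti + 1)) Es.
have {}tEs := tEs ltac:(lra).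
have : 0 <= (ti + 1) * (8 * rho ^+ 2 * N%:R * S).
  by apply: mulr_ge0; [lra|exact: mulr_ge0].
have : 0 <= (ti + 1) * (8 * rho ^+ 2 * N%:R * Er).
  by apply: mulr_ge0; [lra|exact: mulr_ge0].
have : 0 <= 4 * ti * W ^+ 2 * Er by rewrite mulr_ge0.
have : 0 <= (ti + 1) * S by rewrite mulr_ge0 //; lra.
have : 0 <= energy s := energy_ge0 _ _.
rewrite /K; lra.
Qed.

(** The two losses in [energy_relax] are at least [k] times the quantity that coercivity compares
    with [energy q]. *)
Lemma energy_contraction beta : 0 < beta < 1 ->
  exists2 c, 0 < c & forall q g,
  (forall i j, e i j -> q i j - q j i = g i - g j) ->
  energy (fun i j => (1 - beta) *: q i j + beta *: reflect_z q i j) <=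
  (1 - c) * energy q.
Proof.
case/andP=> b0 b1; have [C C0 coer] := energy_coercive.
pose k := Num.min (4 * rho * beta) (beta * (1 - beta)).
have k0 : 0 < k by rewrite lt_min !mulr_gt0 // subr_gt0.
exists (k / C) => [|q g /coer]; first by rewrite divr_gt0.
rewrite energy_relax //; set S := \sum_i _; set Er := energy (fun i j => _ - _).
move=> H.
have S0 : 0 <= S := sumsq_ge0 _.
have Er0 : 0 <= Er := energy_ge0 _ _.
have kS : k * S <= 4 * rho * beta * S by rewrite ler_wpM2r // ge_min lexx.
have kE : k * Er <= beta * (1 - beta) * Er.
  by rewrite ler_wpM2r // ge_min lexx orbT.
suff : k / C * energy q <= k * (S + Er) by lra.
by rewrite -mulrA ler_pM2l // ler_pdivrMl.
Qed.

(** [alpha_hat] for an abstract node input [v]. *)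
Definition node_est z v (i : 'I_N) : 'cV[R]_D :=
  (weight i)^-1 *: (v i + \sum_(j | e i j) z i j).

(** The field [z - T z] of the overview, written out. *)
Definition residual z v (i j : 'I_N) : 'cV[R]_D :=
  z i j + z j i - (2 * rho) *: node_est z v j.

Lemma residual_antisym z v i j :
  residual z v i j - residual z v j i
  = (2 * rho) *: node_est z v i - (2 * rho) *: node_est z v j.
Proof.
by rewrite /residual; apply/matrixP => k l; rewrite !mxE; ring.
Qed.

(** The residual is affine in [(z, v)]: moving [z] by [- beta] times it acts through the linear part
    of the reflection, and the input enters only through [node_est]. *)
Lemma residual_step beta z v z' v' :
  (forall i j, e i j -> z' i j = z i j - beta *: residual z v i j) ->
  forall i j, e i j -> residual z' v' i j =
    (1 - beta) *: residual z v i j + beta *: reflect_z (residual z v) i j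
    - (2 * rho / weight j) *: (v' j - v j).
Proof.
move=> zz' i j eij.
have aj : node_est z' v' j = node_est z v j + (weight j)^-1 *: (v' j - v j)
                             - beta *: agg (residual z v) j.
  rewrite /node_est /agg (eq_bigr _ (fun k => zz' j k)) sumrB -scaler_sumr.
  rewrite (scalerA beta) (mulrC beta) -scalerA -scalerDr -scalerBr.
  by congr (_ *: _); apply/matrixP => k l; rewrite !mxE; ring.
rewrite {1}/residual aj !zz' // 1?e_sym // /reflect_z.
apply/matrixP => k l; rewrite !mxE; ring.
Qed.

Lemma fast_step beta : 0 < beta < 1 ->
  exists2 c, 0 < c & exists2 C, 0 < C & forall z v z' v',
  (forall i j, e i j -> z' i j = z i j - beta *: residual z v i j) ->
  energy (residual z' v') <=
  (1 - c) * energy (residual z v) + C * \sum_i sq (v' i - v i).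
Proof.
move=> /energy_contraction[c c0 contr].
have k0 : 0 < 1 + (c / 2)^-1 by rewrite addr_gt0 // invr_gt0 divr_gt0.
(* Young with weight [c / 2] spends half of the contraction, as
   [(1 + c / 2) * (1 - c) <= 1 - c / 2]; the weights are at least 1, and each node is counted at
   most [N] times. *)
pose C := (1 + (c / 2)^-1) * (4 * rho ^+ 2) * N%:R.
have rr0 : 0 <= 4 * rho ^+ 2 by rewrite mulr_ge0 // sqr_ge0.
have C0 : 0 <= C by rewrite !mulr_ge0 // ltW.
exists (c / 2); first by rewrite divr_gt0.
exists (C + 1) => [|z v z' v' /(residual_step v') zz']; first by lra.
set M := fun i j => (1 - beta) *: residual z v i j
                    + beta *: reflect_z (residual z v) i j.
have EM : energy M <= (1 - c) * energy (residual z v).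
  apply: (contr _ (fun i => (2 * rho) *: node_est z v i)) => i j _.
  exact: residual_antisym.
have M0 : 0 <= energy M := energy_ge0 _ _.
set d := fun j => v' j - v j.
have step1 : energy (residual z' v') <=
  (1 + c / 2) * energy M + C * \sum_i sq (d i).
  apply: (@le_trans _ _ ((1 + c / 2) * energy M +
     ((1 + (c / 2)^-1) * (4 * rho ^+ 2)) * esum (fun i j => sq (d j)))).
    rewrite -!esumZ -esumD; apply: ler_esum => i j eij.
    rewrite zz' // -/(M i j) -/(d j) sqB.
    have := youngN (M i j) ((2 * rho / weight j) *: d j)
      (divr_gt0 c0 (ltr0Sn _ 1)).
    have : sq ((2 * rho / weight j) *: d j) <= 4 * rho ^+ 2 * sq (d j).
      rewrite sqZ ler_wpM2r ?sq_ge0 //.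
      have -> : 4 * rho ^+ 2 = (2 * rho) ^+ 2 by ring.
      rewrite lerXn2r ?nnegrE ?divr_ge0 ?mulr_ge0 ?(ltW rho_gt0) //.
        by rewrite ltW // weight_gt0.
      rewrite ler_piMr ?mulr_ge0 ?(ltW rho_gt0) //.
      by rewrite invf_le1 ?weight_gt0 // lerDl mulr_ge0 // ltW.
    set X := sq _; move=> HX.
    have := ler_wpM2l (ltW k0) HX.
    by lra.
  rewrite lerD2l esumC // /C -[X in _ <= X]mulrA.
  apply: ler_wpM2l; first by apply: mulr_ge0 => //; exact: ltW.
  by apply: esum_node_le => i; apply: sq_ge0.
apply: le_trans step1 _.
have h1 : (1 + c / 2) * energy M <=
   (1 + c / 2) * ((1 - c) * energy (residual z v)).
  by rewrite ler_pM2l //; lra.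
have E0 : 0 <= energy (residual z v) := energy_ge0 _ _.
have : 0 <= c * c / 2 * energy (residual z v).
  by rewrite !mulr_ge0 ?(ltW c0).
have : 0 <= \sum_i sq (d i) := sumsq_ge0 _.
lra.
Qed.

(** At node [i] the edge variables sum to [weight i *: node_est z v i - v i], and subtracting
    [rho * deg_i] copies of the estimate leaves [node_est z v i - v i]. This ties the mean estimate
    to the mean input. *)
Lemma residual_sum z v :
  \sum_i \sum_(j | e i j) residual z v i j
  = 2 *: \sum_i (node_est z v i - v i).
Proof.
have swap (F : 'I_N -> 'I_N -> 'cV[R]_D) :
    \sum_i \sum_(j | e i j) F j i = \sum_i \sum_(j | e i j) F i j.
  rewrite [RHS](exchange_big_dep predT) //=.
  by apply: eq_bigr => j _; apply: eq_bigl => i; rewrite e_sym.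
have -> : \sum_i \sum_(j | e i j) residual z v i j
  = \sum_i \sum_(j | e i j) (2 *: z i j - (2 * rho) *: node_est z v i).
  rewrite /residual; under eq_bigr do rewrite sumrB big_split /=.
  rewrite sumrB big_split /= (swap z).
  rewrite (swap (fun i j => (2 * rho) *: node_est z v i)).
  under [RHS]eq_bigr do rewrite sumrB -scaler_sumr.
  by rewrite [RHS]sumrB -scaler_sumr scaler_nat mulr2n.
rewrite scaler_sumr; apply: eq_bigr => i _.
rewrite sumrB -scaler_sumr sumr_const.
have -> : #|[pred j | e i j]| = deg e i.
  by apply: eq_card => j; rewrite /neighbors !inE.
have -> : \sum_(j | e i j) z i j = weight i *: node_est z v i - v i.
  by rewrite scalerA divff ?gt_eqF ?weight_gt0 // scale1r addrC addKr.
rewrite -[X in _ - X]scaler_nat; apply/matrixP => k l; rewrite !mxE; ring.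
Qed.

(** The error splits in two: estimate against mean estimate, bounded through the antisymmetric part
    of the residual and connectedness, and mean estimate against mean input, bounded by
    [residual_sum]. *)
Lemma tracking_error : exists2 C, 0 < C & forall z v i,
  sq (node_est z v i - N%:R^-1 *: \sum_k v k) <= C * energy (residual z v).
Proof.
have [C C0 disC] := @disagreement_le R N D e e_conn.
have N0 : 0 <= N%:R :> R := ler0n _ _.
have r2 : 0 < rho ^+ 2 by rewrite exprn_gt0.
pose K := 2 * N%:R ^- 2 * N%:R ^+ 2 * (C / rho ^+ 2 + 1).
have K0 : 0 <= K.
  by rewrite !mulr_ge0 ?invr_ge0 ?exprn_ge0 // addr_ge0 // divr_ge0 ?ltW.
exists (K + 1) => [|z v i]; first by lra.
set a := node_est z v; set q := residual z v.
have E0 : 0 <= energy q := energy_ge0 _ _.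
have Nn0 : N%:R != 0 :> R by rewrite pnatr_eq0; case: {+}N i => // -[].
have GE : energy (fun k l => a k - a l) <= energy q / rho ^+ 2.
  rewrite ler_pdivlMr // mulrC.
  apply: (@le_trans _ _ (2^-1 * energy q + 2^-1 * energy (fun i j => q j i))).
    rewrite -!esumZ -esumD; apply: ler_esum => k l _.
    have : sq ((2 * rho) *: (a k - a l)) <= 2 * (sq (q k l) + sq (q l k)).
      by rewrite scalerBr -residual_antisym sqB_le.
    by rewrite sqZ exprMn; lra.
  by rewrite /energy [X in _ + _ * X]esumC //; lra.
have -> : a i - N%:R^-1 *: \sum_k v k =
  N%:R^-1 *: (\sum_k (a i - a k) + \sum_k (a k - v k)).
  rewrite !sumrB addrA subrK sumr_const card_ord -[a i *+ N]scaler_nat.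
  by rewrite scalerBr scalerA mulVf // scale1r.
rewrite sqZ.
have h1 : sq (\sum_k (a i - a k)) <= N%:R ^+ 2 * (C / rho ^+ 2) * energy q.
  apply: le_trans (sq_sum_le _ _) _; rewrite card_ord expr2 -!mulrA.
  rewrite ler_wpM2l //.
  apply: (@le_trans _ _ (\sum_(k < N) C * (energy q / rho ^+ 2))).
    apply: ler_sum => k _; apply: le_trans (disC a i k) _.
    by rewrite ler_pM2l.
  by rewrite sumr_const card_ord -mulr_natl; lra.
have h2 : sq (\sum_k (a k - v k)) <= N%:R ^+ 2 * energy q.
  have : sq (2 *: \sum_k (a k - v k)) <= N%:R ^+ 2 * energy q.
    rewrite -residual_sum; apply: le_trans (sq_sum_le _ _) _.
    rewrite card_ord expr2 -mulrA ler_wpM2l // mulr_sumr.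
    apply: ler_sum => k _; apply: le_trans (sq_sum_le _ _) _.
    by rewrite card_ord.
  have := sq_ge0 (\sum_k (a k - v k)).
  by rewrite sqZ; lra.
apply: (@le_trans _ _ (N%:R^-1 ^+ 2 *
   (2 * (N%:R ^+ 2 * (C / rho ^+ 2) * energy q + N%:R ^+ 2 * energy q)))).
  rewrite ler_wpM2l ?sqr_ge0 //; apply: le_trans (sqD_le _ _) _; lra.
rewrite exprVn; rewrite /K; lra.
Qed.

End Consensus.

(** * Gradient of the total cost: strong monotonicity and Lipschitz continuity *)

Lemma submxcolZ (R : realType) N (n : 'I_N -> nat) a
    (v : 'cV[R]_(\sum_i n i)) i : submxcol (a *: v) i = a *: submxcol v i.
Proof. by apply/matrixP => k l; rewrite !mxE. Qed.

Section Cost.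
Local Open Scope classical_set_scope.
Variables (R : realType) (N : nat) (n : 'I_N -> nat).
Variable f : forall i : 'I_N, 'cV[R]_(n i) -> R.
Hypothesis f_diff : forall i x, differentiable (f (i := i)) x.

Local Notation F := (total_cost f).

Definition cost_grad (x : 'cV[R]_(\sum_i n i)) : 'cV[R]_(\sum_i n i) :=
  \mxcol_i grad (f (i := i)) (submxcol x i).

Lemma derive_grad d (g : 'cV[R]_d -> R) x v :
  differentiable g x -> 'D_v g x = dot (grad g x) v.
Proof.
move=> gx; rewrite deriveE // [in LHS](matrix_sum_delta v) linear_sum.
apply: eq_bigr => k _; rewrite big_ord1 linearZ /= -deriveE // mxE.
by rewrite mulrC.
Qed.

(** The limit is taken block by block, since differentiability is given for each [f i]
    separately. *)
Lemma cost_quotient_cvg x v :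
  h^-1 * (F (x + h *: v) - F x) @[h --> 0^'+] --> dot (cost_grad x) v.
Proof.
rewrite -[v in dot _ v](submxcolK v) dot_mxcol.
have -> : (fun h => h^-1 * (F (x + h *: v) - F x)) =
  (fun h => \sum_i h^-1 *:
    (f (h *: submxcol v i + submxcol x i) - f (submxcol x i))).
  apply/funext => h; rewrite -scaler_sumr sumrB; congr (_ * (_ - _)).
  by apply: eq_bigr => i _; rewrite submxcolD submxcolZ addrC.
apply: cvg_big => [|i _]; first exact: add_continuous.
rewrite -derive_grad //.
by apply: cvg_dnbhs_at_right; apply: diff_derivable.
Qed.

(** [t * K] holds the second-order part of the strong convexity inequality and vanishes in the
    limit. *)
Lemma cost_grad_le x v B K :
  (forall t, 0 < t < 1 -> F (x + t *: v) - F x <= t * (B + t * K)) ->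
  dot (cost_grad x) v <= B.
Proof.
move=> H; have c1 := @cost_quotient_cvg x v.
have c2 : B + h * K @[h --> 0^'+] --> B.
  rewrite -{2}(addr0 B) -{2}(mul0r K).
  apply: cvgD; first exact: cvg_cst.
  apply: cvgM; last exact: cvg_cst.
  exact: cvg_at_right_filter.
apply: ler_cvg_to c1 c2 _; near=> t.
have t0 : 0 < t by near: t; exact: nbhs_right_gt.
have t1 : t < 1 by near: t; exact: nbhs_right_lt.
by rewrite ler_pdivrMl // H // t0.
Unshelve. all: by end_near.
Qed.

Lemma cost_grad_ge x v B :
  (forall t, 0 < t -> t * B <= F (x + t *: v) - F x) ->
  B <= dot (cost_grad x) v.
Proof.
move=> H; have c1 := @cost_quotient_cvg x v.
apply: ler_cvg_to (@cvg_cst _ _ _ _ _) c1 _; near=> t.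
have t0 : 0 < t by near: t; exact: nbhs_right_gt.
by rewrite ler_pdivlMl // H.
Unshelve. all: by end_near.
Qed.

Variables mu : R.
Hypothesis f_sconvex : strongly_convex mu F.

Lemma cost_above_tangent x y :
  F x + dot (cost_grad x) (y - x) + mu / 2 * sq (y - x) <= F y.
Proof.
suff : dot (cost_grad x) (y - x) <= F y - F x - mu / 2 * sq (y - x) by lra.
apply: (@cost_grad_le _ _ _ (mu / 2 * sq (y - x))) => t /andP[t0 t1].
have t01 : 0 <= t <= 1 by rewrite !ltW.
have := f_sconvex y x t01; rewrite enorm_sqr.
have -> : t *: y + (1 - t) *: x = x + t *: (y - x).
  by apply/matrixP => i j; rewrite !mxE; ring.
by lra.
Qed.

Lemma cost_grad_monotone x y :
  mu * sq (x - y) <= dot (x - y) (cost_grad x - cost_grad y).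
Proof.
have := cost_above_tangent x y; have := cost_above_tangent y x.
rewrite -(sqN (y - x)) opprB -(opprB x y) !(dotNr, dotDr) !(dotDl, dotNl).
rewrite !(dotC _ (cost_grad _)).
by lra.
Qed.

Variable c : R.
Hypothesis f_smooth : forall i, elipschitz c (grad (f (i := i))).

Lemma cost_grad_lipschitz x y :
  sq (cost_grad x - cost_grad y) <= c ^+ 2 * sq (x - y).
Proof.
rewrite -(submxcolK (x - y)) -mxcolB !dot_mxcol mulr_sumr.
apply: ler_sum => i _; rewrite submxcolB -!enorm_sqr.
have := f_smooth (i := i) (submxcol x i) (submxcol y i).
rewrite -exprMn => H; rewrite lerXn2r ?nnegrE ?sqrtr_ge0 //.
exact: le_trans (sqrtr_ge0 _) H.
Qed.

End Cost.

(* Joins the normed and the complete structures of matrices. *)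
HB.instance Definition _ (R : realType) (p q : nat) :=
  Uniform_isComplete.Build 'M[R]_(p, q) (@mx_complete R p q).

(** * Fixed points of contractions in the Euclidean norm *)

Section FixedPoint.
Local Open Scope classical_set_scope.
Variables (R : realType) (d : nat).
Implicit Types x y : 'cV[R]_d.

Lemma sq_le_norm x : sq x <= d%:R * `|x| ^+ 2.
Proof.
rewrite mulr_natl -{3}(card_ord d) -sumr_const; apply: ler_sum => k _.
rewrite -expr2 -real_normK ?num_real // lerXn2r ?nnegrE ?normr_ge0 //.
rewrite [leRHS]mx_normrE.
exact: (@le_bigmax _ R _ 0 (fun ij => `|x ij.1 ij.2|) (k, ord0)).
Qed.

Lemma norm_le_sq x : `|x| ^+ 2 <= sq x.
Proof.
have [x0|/mx_norm_neq0[[k j] kE]] := eqVneq (mx_norm x) 0.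
  by rewrite [`|x|]x0 expr0n sq_ge0.
rewrite [`|x|]kE /= ord1 real_normK ?num_real // /dot (bigD1 k) //= -expr2.
by rewrite lerDl; apply: sumr_ge0 => l _; rewrite -expr2 sqr_ge0.
Qed.

(* A high enough iterate contracts the max norm, for which the library states
   Banach's theorem. *)
Lemma euclidean_fixed_point (T : 'cV[R]_d -> 'cV[R]_d) (k : R) :
  0 <= k < 1 -> (forall x y, sq (T x - T y) <= k * sq (x - y)) ->
  exists p, p = T p.
Proof.
case/andP=> k0 k1 Tk.
have iterT j x y : sq (iter j T x - iter j T y) <= k ^+ j * sq (x - y).
  elim: j => [|j IH] /=; first by rewrite mul1r.
  apply: le_trans (Tk _ _) _; rewrite exprS -mulrA ler_wpM2l //.
(* The squared Euclidean norm lies between the squared max norm and [d] times it, so the bound 1/4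
   on squares makes the [j]-th iterate a 1/2-contraction of the max norm. The added 1 covers
   [d = 0]. *)
have [j Hj] : exists j, k ^+ j * (d%:R + 1) < 1 / 4.
  have d1 : 0 < d%:R + 1 :> R by rewrite ltr_wpDl.
  have e0 : 0 < 1 / 4 / (d%:R + 1) :> R by rewrite divr_gt0.
  have /cvgr0Pnorm_lt /(_ _ e0) : GRing.exp k @ \oo --> (0 : R).
    by apply: cvg_expr; rewrite ger0_norm.
  case=> j _ /(_ j (leqnn j)) /=; rewrite ger0_norm ?exprn_ge0 // => H.
  by exists j; rewrite -ltr_pdivlMr.
have kj0 : 0 <= k ^+ j by rewrite exprn_ge0.
have kj1 : k ^+ j < 1.
  apply: le_lt_trans (lt_trans Hj _); last by lra.
  by rewrite ler_peMr // lerDr.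
pose g : {fun [set: 'cV[R]_d] >-> [set: 'cV[R]_d]} := totalfun (iter j T).
have ctr : is_contraction g.
  exists (2^-1)%:nng; split; first by rewrite /=; lra.
  move=> [x y] _ /=; rewrite -(@ler_pXn2r _ 2) ?nnegrE ?mulr_ge0 //.
  apply: le_trans (norm_le_sq _) _; apply: le_trans (iterT j x y) _.
  have := ler_wpM2l kj0 (sq_le_norm (x - y)).
  have n0 := sqr_ge0 `|x - y|.
  have := ler_wpM2r n0 (ltW Hj).
  have := mulr_ge0 kj0 n0.
  rewrite exprMn; lra.
have [p _ pg] := banach_fixed_point ctr closedT (ex_intro _ 0 I).
(* [p] and [T p] are both fixed by the [j]-th iterate, so they coincide because [k ^+ j < 1]. *)
exists p; apply/eqP; rewrite -subr_eq0 -sq_eq0 eq_le sq_ge0 andbT.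
have := iterT j p (T p).
have -> : iter j T (T p) = T (iter j T p) by rewrite -iterSr.
rewrite -[iter j T p]pg => H; have S0 := sq_ge0 (p - T p).
rewrite leNgt; apply/negP => S1.
suff : k ^+ j * sq (p - T p) < sq (p - T p) by rewrite ltNge H.
by rewrite gtr_pMl.
Qed.

End FixedPoint.

(** * Full row rank, optimality conditions, existence and uniqueness of the saddle point *)

(** A right inverse [B] of [M] recovers [l] as [B^T *m (M^T *m l)]. *)
Lemma full_row_rank_coercive (R : realType) (m d : nat) (M : 'M[R]_(m, d)) :
  \rank M = m -> exists2 C, 0 < C & forall l, sq l <= C * sq (M^T *m l).
Proof.
move=> /eqP/row_freeP[B MB]; have [C C0 HC] := sq_mulmx_le B^T.
by exists C => // l; rewrite -{1 2}[l]mul1mx -trmx1 -MB trmx_mul -mulmxA.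
Qed.

Lemma gram_unitmx (R : realType) (m d : nat) (M : 'M[R]_(m, d)) :
  \rank M = m -> M *m M^T \in unitmx.
Proof.
move=> /eqP Mfree; rewrite -row_free_unit; apply: inj_row_free => v vG.
have : sq (M^T *m v^T) == 0.
  rewrite dot_mulmxr trmxK mulmxA dotC dotE trmxK !mulmxA -(mulmxA v).
  by rewrite vG mul0mx mxE.
rewrite sq_eq0 -trmx_mul => /eqP/(congr1 trmx); rewrite trmxK trmx0 => vM.
by apply: (row_free_inj Mfree); rewrite vM mul0mx.
Qed.

Section Saddle.
Variables (R : realType) (N m : nat) (n : 'I_N -> nat).
Variable f : forall i : 'I_N, 'cV[R]_(n i) -> R.
Variables (A : forall i : 'I_N, 'M[R]_(m, n i)) (b : 'cV[R]_m).
Hypothesis f_diff : forall i x, differentiable (f (i := i)) x.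
Variables mu c : R.
Hypotheses (mu_gt0 : 0 < mu) (f_sconvex : strongly_convex mu (total_cost f)).
Hypothesis f_smooth : forall i, elipschitz c (grad (f (i := i))).

Local Notation F := (total_cost f).
Local Notation gradF := (cost_grad f).
Local Notation M := (\mxrow_i A i).

Lemma lagrangianE x l : lagrangian f A b x l = F x + dot l (M *m x - b).
Proof.
by rewrite /lagrangian dotE -[in RHS](submxcolK x) mul_mxrow_mxcol submxcolK.
Qed.

Definition kkt (x : 'cV[R]_(\sum_i n i)) (l : 'cV[R]_m) : Prop :=
  gradF x + M^T *m l = 0 /\ M *m x = b.

(** Necessity tests the multiplier inequality along [M *m x - b] and the primal one along minus the
    gradient of the Lagrangian; sufficiency is the tangent inequality. *)
Lemma saddle_pointP x l : saddle_point f A b x l <-> kkt x l.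
Proof.
split=> [[Hx Hl]|[Gx Mx]].
  have Mx : M *m x = b.
    have := Hl (l + (M *m x - b)); rewrite !lagrangianE dotDl => h.
    apply/eqP; rewrite -subr_eq0 -sq_eq0 eq_le sq_ge0 andbT; lra.
  split=> //; apply/eqP; rewrite -sq_eq0 eq_le sq_ge0 andbT.
  set g := _ + _.
  have : - dot (M^T *m l) (- g) <= dot (gradF x) (- g).
    apply: cost_grad_ge => // t t0.
    have := Hx (x + t *: - g); rewrite !lagrangianE Mx subrr dotC dot0l addr0.
    rewrite mulmxDr Mx [b + _]addrC addrK dot_mulmxr dotZr; lra.
  by rewrite {2}/g dotDl !dotNr; lra.
split=> [y|k]; rewrite !lagrangianE Mx subrr !(dotC _ 0) !dot0l // addr0.
have := cost_above_tangent f_diff f_sconvex x y.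
have -> : gradF x = - (M^T *m l) by apply/eqP; rewrite -addr_eq0 Gx.
rewrite dotNl -dot_mulmxr mulmxBr Mx.
have : 0 <= mu / 2 * sq (y - x).
  by rewrite mulr_ge0 ?sq_ge0 // divr_ge0 // ltW.
by lra.
Qed.

(** The gradient difference lies in the range of [M^T], hence is orthogonal to the difference of two
    feasible points, and strong monotonicity gives [x = x']. Coercivity of [M^T] then gives
    [l = l']. *)
Lemma kkt_unique x l x' l' : \rank M = m -> kkt x l -> kkt x' l' ->
  (x, l) = (x', l').
Proof.
move=> /full_row_rank_coercive[C C0 HC] [Gx Mx] [Gx' Mx'].
have gE y k : gradF y + M^T *m k = 0 -> gradF y = - (M^T *m k).
  by move=> /eqP; rewrite addr_eq0 => /eqP.
have xx : x = x'.
  apply/eqP; rewrite -subr_eq0 -sq_eq0 eq_le sq_ge0 andbT.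
  rewrite -(pmulr_rle0 _ mu_gt0).
  apply: le_trans (cost_grad_monotone f_diff f_sconvex x x') _.
  rewrite (gE _ _ Gx) (gE _ _ Gx') opprK [- (_ *m _) + _]addrC -mulmxBr.
  by rewrite dot_mulmxr trmxK mulmxBr Mx Mx' subrr dot0l.
congr (_, _) => //; apply/eqP; rewrite -subr_eq0 -sq_eq0 eq_le sq_ge0 andbT.
apply: le_trans (HC _) _; rewrite mulmxBr.
have -> : M^T *m l = M^T *m l'.
  by apply: (addrI (gradF x)); rewrite Gx xx Gx'.
by rewrite subrr dot0l mulr0.
Qed.

(* The gradient step followed by the orthogonal projection onto M x = b is a
   contraction, and its fixed point satisfies the optimality conditions. *)
Lemma kkt_exists : \rank M = m -> exists x l, kkt x l.
Proof.
move=> Mrank; have GU := gram_unitmx Mrank.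
(* The Moore-Penrose inverse of [M]: [W *m b] is feasible, and [P] below is the orthogonal
   projection onto the kernel of [M]. *)
pose W := M^T *m invmx (M *m M^T).
have MW : M *m W = 1%:M by rewrite /W mulmxA mulmxV.
pose P := 1%:M - W *m M.
have MP : M *m P = 0 by rewrite /P mulmxBr mulmx1 mulmxA MW mul1mx subrr.
have Psym : P^T = P.
  rewrite /P /W linearB /= trmx1 !trmx_mul trmxK trmx_inv trmx_mul trmxK.
  by rewrite mulmxA.
have PP : P *m P = P.
  by rewrite {1}/P mulmxBl mul1mx -mulmxA MP mulmx0 subr0.
have P_le v : sq (P *m v) <= sq v.
  have : dot (P *m v) (v - P *m v) = 0.
    rewrite dotC dot_mulmxr Psym mulmxBr mulmxA PP subrr.
    by rewrite dot0l.
  have := sq_ge0 (v - P *m v).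
  rewrite sqB dotDr dotNr (dotC v); lra.
have q0 : 0 < c ^+ 2 + mu ^+ 2 by rewrite ltr_wpDl ?sqr_ge0 // exprn_gt0.
(* The step size satisfies [s * c ^+ 2 <= mu], so that [1 - 2 * s * mu + s ^+ 2 * c ^+ 2 <= 1 - s *
   mu]; the [mu ^+ 2] in the denominator ensures [s * mu <= 1]. *)
pose s := mu / (c ^+ 2 + mu ^+ 2).
pose T x := W *m b + P *m (x - s *: gradF x).
have s0 : 0 < s by rewrite divr_gt0.
have sE : s * (c ^+ 2 + mu ^+ 2) = mu by rewrite /s divfK // gt_eqF.
have smu : s * mu <= 1.
  rewrite /s mulrAC ler_pdivrMr // mul1r -expr2 lerDr sqr_ge0 //.
have s2 := mulr_gt0 s0 mu_gt0.
have [x xT] : exists x, x = T x.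
  apply: (@euclidean_fixed_point R _ T (1 - s * mu)) => [|x y].
    by apply/andP; split; lra.
  rewrite /T opprD addrACA subrr add0r -mulmxBr.
  apply: le_trans (P_le _) _.
  have -> : x - s *: gradF x - (y - s *: gradF y)
    = (x - y) - s *: (gradF x - gradF y).
    by apply/matrixP => i j; rewrite !mxE; ring.
  rewrite (sqB (x - y)) sqZ dotZr.
  have h1 := ler_wpM2l (ltW s0) (cost_grad_monotone f_diff f_sconvex x y).
  have h2 := ler_wpM2l (sqr_ge0 s) (cost_grad_lipschitz f_smooth x y).
  have h3 : s ^+ 2 * (c ^+ 2 * sq (x - y)) <= s * (mu * sq (x - y)).
    have sc : s * c ^+ 2 <= mu.
      by rewrite -[leRHS]sE mulrDr lerDl mulr_ge0 ?sqr_ge0 // ltW.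
    have := ler_wpM2l (ltW s0) (ler_wpM2r (sq_ge0 (x - y)) sc).
    by rewrite expr2 -!mulrA.
  lra.
have Mx : M *m x = b.
  rewrite xT /T mulmxDr [M *m (W *m _)]mulmxA [M *m (P *m _)]mulmxA.
  by rewrite MW mul1mx MP mul0mx addr0.
have Px : P *m x = x - W *m b by rewrite /P mulmxBl mul1mx -mulmxA Mx.
(* At the fixed point [P *m gradF x = 0], so [gradF x = W *m M *m gradF x] lies in the range of
   [M^T]; the multiplier is read off from [W]. *)
exists x, (- (invmx (M *m M^T) *m M *m gradF x)); split=> //.
have : P *m gradF x = 0.
  have : P *m (x - s *: gradF x) = P *m x.
    by rewrite Px [in RHS]xT /T addrAC subrr add0r.
  rewrite mulmxBr -scalemxAr => /eqP.
  rewrite -subr_eq0 addrAC subrr add0r oppr_eq0 scaler_eq0 gt_eqF //=.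
  by move/eqP.
by rewrite /P mulmxBl mul1mx /W mulmxN !mulmxA.
Qed.

End Saddle.

(** * Lyapunov analysis of the averaged primal-dual flow under disturbances *)

Lemma pos_below (R : realType) (s : seq R) : all (fun x => 0 < x) s ->
  exists2 r, 0 < r & {in s, forall x, r <= x}.
Proof.
elim: s => [|x s IH] /=; first by exists 1.
case/andP=> x0 /IH[r r0 Hr]; exists (Num.min x r); first by rewrite lt_min x0.
by move=> y; rewrite inE => /orP[/eqP->|/Hr]; rewrite ge_min ?lexx // => ->;
  rewrite orbT.
Qed.

Section Slow.
Variables (R : realType) (N m d : nat) (M : 'M[R]_(m, d)).

Implicit Types (y g h : 'cV[R]_d) (L K : 'I_N -> 'cV[R]_m).

Definition avg L : 'cV[R]_m := N%:R^-1 *: \sum_i L i.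

Lemma avgD L K : avg (fun i => L i + K i) = avg L + avg K.
Proof. by rewrite /avg big_split scalerDr. Qed.

Lemma avgZ a L : avg (fun i => a *: L i) = a *: avg L.
Proof. by rewrite /avg -scaler_sumr !scalerA mulrC. Qed.

Lemma invN_le1 : N%:R^-1 ^+ 2 * N%:R <= 1 :> R.
Proof.
case: {+}N => [|k]; first by rewrite mulr0.
by rewrite expr2 -mulrA mulVf ?pnatr_eq0 // mulr1 invf_le1 ?ltr0Sn // ler1n.
Qed.

Lemma sq_avg_le L : sq (avg L) <= \sum_i sq (L i).
Proof.
rewrite sqZ; apply: le_trans (ler_wpM2l (sqr_ge0 _) (sq_sum_le _ _)) _.
rewrite card_ord mulrA ler_piMl ?sumsq_ge0 //; exact: invN_le1.
Qed.

Lemma sum_deviation L : \sum_i (L i - avg L) = 0.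
Proof.
rewrite sumrB sumr_const card_ord -scaler_nat scalerA.
have [N0|N0] := eqVneq N 0%N; last by rewrite divff ?pnatr_eq0 // scale1r subrr.
have Nr0 : N%:R = 0 :> R by rewrite N0.
rewrite Nr0 mul0r scale0r subr0 big1 // => i _.
by have := ltn_ord i; rewrite {2}N0.
Qed.

Lemma dot_avg L v : \sum_i dot (L i) (N%:R^-1 *: v) = dot (avg L) v.
Proof. by rewrite -dot_suml dotZr /avg dotZl. Qed.

Definition slow_energy y L : R := sq y + \sum_i sq (L i).

Lemma slow_energy_ge0 y L : 0 <= slow_energy y L.
Proof. by rewrite addr_ge0 ?sq_ge0 // sumsq_ge0. Qed.

Definition lyapunov (eps : R) y L : R :=
  slow_energy y L + 2 * eps * dot (avg L) (M *m y).

(** Half the derivative of [lyapunov eps] at [(y, L)] in the direction [(h, K)]. *)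
Definition lyapunov_slope (eps : R) y L h K : R :=
  dot y h + \sum_i dot (L i) (K i)
  + eps * (dot (avg K) (M *m y) + dot (avg L) (M *m h)).

Lemma lyapunovD eps t y L h K :
  lyapunov eps (y + t *: h) (fun i => L i + t *: K i) =
  lyapunov eps y L + 2 * t * lyapunov_slope eps y L h K
  + t ^+ 2 * lyapunov eps h K.
Proof.
rewrite /lyapunov /lyapunov_slope /slow_energy avgD avgZ mulmxDr -scalemxAr.
have -> : \sum_i sq (L i + t *: K i) = \sum_i sq (L i) +
   2 * t * \sum_i dot (L i) (K i) + t ^+ 2 * \sum_i sq (K i).
  rewrite !mulr_sumr -!big_split; apply: eq_bigr => i _ /=.
  by rewrite sqD sqZ dotZr; ring.
by rewrite (sqD y) sqZ !dot_bilin; ring.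
Qed.

Variables (mu c kappa : R).
Hypotheses (mu_gt0 : 0 < mu) (kappa_gt0 : 0 < kappa) (Mrank : \rank M = m).

(** With [dual_field], the flow in error coordinates: [g] stands for the gradient difference, [Ex]
    and [E] for disturbances due to the tracking error. *)
Definition primal_field L g Ex : 'cV[R]_d :=
  - (g + M^T *m avg L + Ex).

Definition dual_field y L (E : 'I_N -> 'cV[R]_m) (i : 'I_N) : 'cV[R]_m :=
  kappa *: (avg L - L i) + N%:R^-1 *: (M *m y) + E i.

Lemma sum_sq_dual_field C1 y L E : sq (M *m y) <= C1 * sq y ->
  \sum_i sq (dual_field y L E i) <=
  4 * (kappa ^+ 2 * \sum_i sq (L i - avg L) + C1 * sq y + \sum_i sq (E i)).
Proof.
move=> My.
apply: (@le_trans _ _ (\sum_i (4 * (kappa ^+ 2 * sq (L i - avg L)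
   + N%:R^-1 ^+ 2 * sq (M *m y) + sq (E i))))).
  apply: ler_sum => i _.
  have := sqD_le (kappa *: (avg L - L i) + N%:R^-1 *: (M *m y)) (E i).
  have := sqD_le (kappa *: (avg L - L i)) (N%:R^-1 *: (M *m y)).
  rewrite !sqZ -(opprB (L i)) sqN /dual_field -(opprB (L i)) => h1 h2.
  have := sq_ge0 (E i); lra.
rewrite -mulr_sumr !big_split -mulr_sumr /= sumr_const card_ord.
rewrite -[X in _ + X + _]mulr_natl mulrA (mulrC N%:R).
have := ler_wpM2r (sq_ge0 (M *m y)) invN_le1.
lra.
Qed.

(** Controls the second-order term of an Euler step and the speed at which the node inputs move. *)
Lemma slow_rate_bound : exists2 C, 0 < C & forall y L g Ex E (Q : R),
  sq g <= c ^+ 2 * sq y -> sq Ex <= Q -> \sum_i sq (E i) <= Q ->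
  slow_energy (primal_field L g Ex) (dual_field y L E)
    <= C * (slow_energy y L + Q).
Proof.
have [C1 C10 HC1] := sq_mulmx_le M; have [C2 C20 HC2] := sq_mulmx_le M^T.
have NR : 0 <= N%:R :> R := ler0n _ _.
have k2 : 0 <= kappa ^+ 2 * (2 + 2 * N%:R).
  by rewrite mulr_ge0 ?sqr_ge0 //; lra.
have c2 := sqr_ge0 c.
exists (4 * (c ^+ 2 + C2 + 2 + C1 + kappa ^+ 2 * (2 + 2 * N%:R))).
  lra.
move=> y L g Ex E Q Hg HEx HE.
have := sum_sq_dual_field L E (HC1 y).
have h1 := sqD_le (g + M^T *m avg L) Ex; have h2 := sqD_le g (M^T *m avg L).
have h3 := HC2 (avg L); have h4 := sq_avg_le L.
have hdev : \sum_i sq (L i - avg L) <= (2 + 2 * N%:R) * \sum_i sq (L i).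
  apply: (@le_trans _ _ (\sum_i (2 * (sq (L i) + sq (avg L))))).
    by apply: ler_sum => i _; apply: sqB_le.
  rewrite -mulr_sumr big_split /= sumr_const card_ord.
  rewrite -[X in _ + X]mulr_natl.
  have := ler_wpM2l NR h4; lra.
have Y0 := sq_ge0 y; have S0 := sumsq_ge0 L; have E0 := sumsq_ge0 E.
have := ler_wpM2l (sqr_ge0 kappa) hdev.
have h5 := ler_wpM2l (ltW C20) h4.
rewrite /slow_energy /primal_field sqN.
set S := \sum_i sq (L i) in h4 h5 hdev S0 *; set Y := sq y in Hg Y0 *.
have Q0 : 0 <= Q := le_trans E0 HE.
have : 0 <= c ^+ 2 * S by rewrite mulr_ge0.
have : 0 <= c ^+ 2 * Q by rewrite mulr_ge0.
have : 0 <= C1 * S by rewrite mulr_ge0 // ltW.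
have : 0 <= C1 * Q by rewrite mulr_ge0 // ltW.
have : 0 <= C2 * Y by rewrite mulr_ge0 // ltW.
have : 0 <= C2 * Q by rewrite mulr_ge0 // ltW.
have : 0 <= kappa ^+ 2 * (2 + 2 * N%:R) * Y by rewrite mulr_ge0.
have : 0 <= kappa ^+ 2 * (2 + 2 * N%:R) * Q by rewrite mulr_ge0.
lra.
Qed.

(* The cross term of the Lyapunov function supplies the dissipation
   - eps |M^T avg L|^2, which full row rank turns into decay of avg L; the
   deviations L i - avg L are damped by kappa and y by strong monotonicity. *)
Lemma lyapunov_slope_bound : exists2 eps, 0 < eps & exists2 k, 0 < k &
  exists2 C, 0 < C &
  (forall y L, slow_energy y L / 2 <= lyapunov eps y L <= 2 * slow_energy y L)
  /\ forall y L g Ex E Q,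
  mu * sq y <= dot y g -> sq g <= c ^+ 2 * sq y ->
  sq Ex <= Q -> \sum_i sq (E i) <= Q ->
  lyapunov_slope eps y L (primal_field L g Ex) (dual_field y L E)
    <= - k * slow_energy y L + C * Q.
Proof.
have [C1 C10 HC1] := sq_mulmx_le M.
have [C0 C00 HC0] := full_row_rank_coercive Mrank.
have c2 := sqr_ge0 c; have NR : 0 <= N%:R :> R := ler0n _ _.
have NC0 : 0 <= N%:R * C0 by rewrite mulr_ge0 // ltW.
(* The first two thresholds keep the cross term below half of [slow_energy]; the third lets strong
   monotonicity absorb the [sq y] terms created by the cross term, the fourth lets [kappa] absorb
   the deviation terms. *)
have [|eps eps0 eps_le] := @pos_below R [:: 1 / 2; 1 / 2 / C1;
  mu / 4 / (c ^+ 2 + 3 * C1); 1 / 8 / kappa].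
  by rewrite /= !divr_gt0 //; lra.
have e1 : eps <= 1 / 2 by apply: eps_le; rewrite !inE eqxx.
have e2 : eps * C1 <= 1 / 2.
  by rewrite -ler_pdivlMr //; apply: eps_le; rewrite !inE eqxx orbT.
have e3 : eps * (c ^+ 2 + 3 * C1) <= mu / 4.
  rewrite -ler_pdivlMr; last by lra.
  by apply: eps_le; rewrite !inE eqxx !orbT.
have e4 : eps * kappa <= 1 / 8.
  by rewrite -ler_pdivlMr //; apply: eps_le; rewrite !inE eqxx !orbT.
(* [tau] is the Young weight for the dual disturbance: its share of the deviations is charged to
   [kappa], its share of the average to the dissipation [eps * sq a]. *)
have [|tau tau0 tau_le] := @pos_below R
  [:: kappa / 8; eps / 8 / (N%:R * C0 + 1)].
  by rewrite /= !divr_gt0 //; lra.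
have t1 : tau <= kappa / 8 by apply: tau_le; rewrite !inE eqxx.
have t2 : tau * (N%:R * C0 + 1) <= eps / 8.
  rewrite -ler_pdivlMr; last by lra.
  by apply: tau_le; rewrite !inE eqxx orbT.
(* The rate [k] fits what remains of the three dissipations, in [y], in the deviations and in the
   average. *)
have [|k k0 k_le] := @pos_below R
  [:: mu / 2; kappa / 4; eps / 8 / (N%:R * C0 + 1)].
  by rewrite /= !divr_gt0 //; lra.
have k1 : k <= mu / 2 by apply: k_le; rewrite !inE eqxx.
have k2 : k <= kappa / 4 by apply: k_le; rewrite !inE eqxx orbT.
have k3 : k * (N%:R * C0 + 1) <= eps / 8.
  rewrite -ler_pdivlMr; last by lra.
  by apply: k_le; rewrite !inE eqxx !orbT.
have m4 : 0 < mu / 2 by rewrite divr_gt0.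
exists eps => //; exists k => //; exists (mu^-1 + tau^-1 + 3).
  by rewrite !addr_gt0 // invr_gt0.
split=> [y L|y L g Ex E Q Hyg Hg HEx HE].
  have := young (avg L) (M *m y) ltr01; have := youngN (avg L) (M *m y) ltr01.
  rewrite invr1 !mul1r => h1 h2.
  have {}h1 := ler_wpM2l (ltW eps0) h1; have {}h2 := ler_wpM2l (ltW eps0) h2.
  have h3 := ler_wpM2l (ltW eps0) (sq_avg_le L).
  have h4 := ler_wpM2l (ltW eps0) (HC1 y).
  have h5 := ler_wpM2r (sq_ge0 y) e2.
  have h6 := ler_wpM2r (sumsq_ge0 L) e1.
  rewrite /lyapunov /slow_energy; apply/andP; split; lra.
set l := avg L; set a := M^T *m l.
set Om := \sum_i sq (L i - l).
have Om0 : 0 <= Om := sumsq_ge0 _.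
have Y0 := sq_ge0 y; have a0 := sq_ge0 a.
have Q0 : 0 <= Q := le_trans (sq_ge0 _) HEx.
(* Each [L i] is split into deviation and average, and full row rank bounds the average by [a]. *)
have SL : \sum_i sq (L i) <= 2 * Om + 2 * (N%:R * C0) * sq a.
  apply: (@le_trans _ _ (\sum_i (2 * (sq (L i - l) + sq l)))).
    by apply: ler_sum => i _; rewrite -{1 2}[L i](subrK l) sqD_le.
  rewrite -mulr_sumr big_split /= sumr_const card_ord -/Om.
  rewrite -[X in _ + X]mulr_natl.
  have := ler_wpM2l NR (HC0 l); rewrite -/a; lra.
(* The coupling [dot a y] cancels below against its opposite from the primal field: the primal-dual
   coupling is skew. *)
have SD : \sum_i dot (L i) (dual_field y L E i) =
    - kappa * Om + dot a y + \sum_i dot (L i) (E i).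
  rewrite /dual_field; under eq_bigr do rewrite 2!dotDr dotZr.
  rewrite !big_split /= -mulr_sumr dot_avg -/l dot_mulmxr -/a.
  have -> : \sum_i dot (L i) (l - L i) = - Om - dot l (\sum_i (L i - l)).
    rewrite dot_sumr -!sumrN -big_split; apply: eq_bigr => i _ /=.
    have H u v : dot u (v - u) = - sq (u - v) + - dot v (u - v) :> R.
      by rewrite !dot_bilin (dotC v u); ring.
    exact: H.
  by rewrite sum_deviation (dotC l) dot0l; ring.
have b1 : - dot y Ex <= mu / 4 * sq y + mu^-1 * Q.
  have := youngN y Ex m4; rewrite invf_div => h.
  have := ler_wpM2l (ltW (_ : 0 < mu^-1)) HEx.
  rewrite invr_gt0 => /(_ mu_gt0); lra.
have b2 : \sum_i dot (L i) (E i) <= tau / 2 * \sum_i sq (L i) + tau^-1 / 2 * Q.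
  have H : \sum_i dot (L i) (E i) <=
      tau / 2 * \sum_i sq (L i) + tau^-1 / 2 * \sum_i sq (E i).
    rewrite !mulr_sumr -big_split; apply: ler_sum => i _ /=.
    have := young (L i) (E i) tau0; lra.
  have ti0 : 0 <= tau^-1 / 2 by rewrite divr_ge0 // invr_ge0 ltW.
  have := ler_wpM2l ti0 HE; lra.
have b3 : - dot a g <= 1 / 4 * sq a + c ^+ 2 * sq y.
  have := youngN a g (_ : 0 < 1 / 2); rewrite invf_div => h.
  have := h ltac:(lra); lra.
have b4 : - dot a Ex <= 1 / 4 * sq a + Q.
  have := youngN a Ex (_ : 0 < 1 / 2); rewrite invf_div => h.
  have := h ltac:(lra); lra.
have b5 : dot (avg (dual_field y L E)) (M *m y) <=
    2 * kappa ^+ 2 * Om + 5 / 2 * C1 * sq y + 2 * Q.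
  have := young (avg (dual_field y L E)) (M *m y) ltr01.
  have := sq_avg_le (dual_field y L E).
  have := sum_sq_dual_field L E (HC1 y); rewrite -/l -/Om.
  have := HC1 y; rewrite invr1; lra.
have -> : lyapunov_slope eps y L (primal_field L g Ex) (dual_field y L E) =
  - dot y g - dot y Ex - kappa * Om + \sum_i dot (L i) (E i) +
  eps * dot (avg (dual_field y L E)) (M *m y)
  + eps * (- dot a g) + eps * (- dot a Ex) - eps * sq a.
  rewrite /lyapunov_slope SD /primal_field -/l (dot_mulmxr M l) -/a.
  rewrite (dotNr y) (dotNr a) !(dotDr y) !(dotDr a) (dotC y a); ring.
have {}b3 := ler_wpM2l (ltW eps0) b3.
have {}b4 := ler_wpM2l (ltW eps0) b4.
have {}b5 := ler_wpM2l (ltW eps0) b5.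
have tSL := ler_wpM2l (ltW tau0) SL.
have kSL := ler_wpM2l (ltW k0) SL.
have p1 := ler_wpM2r Y0 e3.
have p2 : eps * kappa * (kappa * Om) <= 1 / 8 * (kappa * Om).
  by rewrite ler_wpM2r // mulr_ge0 // ltW.
have p3 := ler_wpM2r Om0 t1.
have p4 := ler_wpM2r a0 t2.
have p5 := ler_wpM2r Y0 k1.
have p6 := ler_wpM2r Om0 k2.
have p7 := ler_wpM2r a0 k3.
have p8 := ler_wpM2r Q0 e1.
have p9 : 0 <= eps * C1 * sq y by rewrite !mulr_ge0 // ltW.
have p10 : 0 <= tau * sq a by rewrite mulr_ge0 // ltW.
have p11 : 0 <= k * sq a by rewrite mulr_ge0 // ltW.
have p12 : 0 <= tau^-1 * Q by rewrite mulr_ge0 // invr_ge0 ltW.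
have p13 : 0 <= kappa * Om by rewrite mulr_ge0 // ltW.
have p14 : 0 <= eps * sq a by rewrite mulr_ge0 // ltW.
by rewrite /slow_energy; rewrite expr2 in b5; lra.
Qed.

End Slow.

(** * Error dynamics of the algorithm and decay of the combined energy *)

Lemma sq_submxcol_le (R : realType) N (n : 'I_N -> nat)
    (h : 'cV[R]_(\sum_i n i)) i : sq (submxcol h i) <= sq h.
Proof.
rewrite -{3 4}(submxcolK h) dot_mxcol (bigD1 i) //= lerDl.
by apply: sumr_ge0 => j _; apply: sq_ge0.
Qed.

Section Algorithm.
Variables (R : realType) (N m : nat) (n : 'I_N -> nat) (e : rel 'I_N).
Hypotheses (e_sym : symmetric e) (e_conn : forall i j, connect e i j).
Variables (f : forall i : 'I_N, 'cV[R]_(n i) -> R).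
Variables (A : forall i : 'I_N, 'M[R]_(m, n i)).
Variables (b : 'cV[R]_m) (bs : 'I_N -> 'cV[R]_m).
Hypothesis bs_sum : \sum_i bs i = b.
Hypothesis f_diff : forall i x, differentiable (f (i := i)) x.
Variables mu c : R.
Hypotheses (mu_gt0 : 0 < mu) (f_sconvex : strongly_convex mu (total_cost f)).
Hypothesis f_smooth : forall i, elipschitz c (grad (f (i := i))).
Hypothesis A_rank : \rank (\mxrow_i A i) = m.
Variables (xs : 'cV[R]_(\sum_i n i)) (ls : 'cV[R]_m).
Hypothesis opt : kkt f A b xs ls.
Variables kappa rho beta : R.
Hypotheses (kappa_gt0 : 0 < kappa) (rho_gt0 : 0 < rho) (beta01 : 0 < beta < 1).

Implicit Type s : state R m n.

Local Notation M := (\mxrow_i A i).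
Local Notation gradF := (cost_grad f).

Definition node_input s (i : 'I_N) : 'cV[R]_(m + m) :=
  col_mx (A i *m st_x s i - bs i) (st_lambda s i).

Definition primal_error s : 'cV[R]_(\sum_i n i) := stack_x s - xs.

Definition dual_error s (i : 'I_N) : 'cV[R]_m := st_lambda s i - ls.

Definition slow_dist s : R := slow_energy (primal_error s) (dual_error s).

Definition node_residual s := residual e rho (st_z s) (node_input s).

Definition fast_dist s : R := energy e (node_residual s).

Definition node_error s (i : 'I_N) : 'cV[R]_(m + m) :=
  alpha_hat e A bs rho s i - avg (node_input s).

Definition primal_drift s : 'cV[R]_(\sum_i n i) :=
  primal_field M (dual_error s) (gradF (stack_x s) - gradF xs)
    (\mxcol_i ((A i)^T *m dsubmx (node_error s i))).

Definition dual_drift s (i : 'I_N) : 'cV[R]_m :=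
  dual_field M kappa (primal_error s) (dual_error s)
    (fun k => kappa *: dsubmx (node_error s k) + usubmx (node_error s k)) i.

Lemma alpha_hatE s i :
  alpha_hat e A bs rho s i = node_est e rho (st_z s) (node_input s) i.
Proof.
congr (_ *: (_ + _)); apply: eq_bigl => j.
by rewrite /neighbors inE.
Qed.

(** Since [\sum_i bs i = b = M *m xs], the local shares leave the mean and only the error
    [M *m primal_error s] remains. The index [i] witnesses that [N] is nonzero. *)
Lemma avg_node_input s (i : 'I_N) : avg (node_input s) =
  col_mx (N%:R^-1 *: (M *m primal_error s)) (ls + avg (dual_error s)).
Proof.
have N0 : N%:R != 0 :> R by rewrite pnatr_eq0; case: {+}N i => // -[].
rewrite /avg; have -> : \sum_i node_input s i = col_mx (M *m primal_error s)
    (N%:R *: ls + \sum_i dual_error s i).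
  have -> : M *m primal_error s = \sum_i (A i *m st_x s i - bs i).
    by rewrite /primal_error mulmxBr opt.2 -bs_sum mul_mxrow_mxcol sumrB.
  have -> : N%:R *: ls + \sum_i dual_error s i = \sum_i st_lambda s i.
    by rewrite sumrB sumr_const card_ord scaler_nat addrC subrK.
  rewrite -[LHS]vsubmxK !linear_sum /=.
  congr col_mx; apply: eq_bigr => k _; [exact: col_mxKu|exact: col_mxKd].
by rewrite scale_col_mx scalerDr scalerA mulVf // scale1r.
Qed.

Lemma alpha_split s i :
  alpha_lambda e A bs rho s i =
    dsubmx (node_error s i) + (ls + avg (dual_error s)) /\
  alpha_x e A bs rho s i =
    usubmx (node_error s i) + N%:R^-1 *: (M *m primal_error s).
Proof.
rewrite /alpha_lambda /alpha_x.
have := subrK (avg (node_input s)) (alpha_hat e A bs rho s i).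
rewrite -/(node_error s i) (avg_node_input s i).
move: (node_error s i) => d <-.
by split; rewrite linearD /= ?col_mxKd ?col_mxKu.
Qed.

Local Notation step := (step e f A bs kappa rho beta).

(** Stationarity, [gradF xs = - (M^T *m ls)], turns the multiplier into the gradient difference of
    the error field. *)
Lemma st_x_step gamma s i :
  st_x (step gamma s) i = st_x s i + gamma *: submxcol (primal_drift s) i.
Proof.
rewrite /= -scalerN; congr (_ + _ *: _).
rewrite /primal_drift /primal_field submxcolN; congr (- _).
have -> : gradF (stack_x s) - gradF xs + M^T *m avg (dual_error s) =
    gradF (stack_x s) + M^T *m (ls + avg (dual_error s)).
  rewrite mulmxDr addrA; congr (_ + _); congr (_ + _).
  by apply/eqP; rewrite eq_sym -addr_eq0 addrC opt.1.
rewrite !submxcolD tr_mxrow mxcol_mul /cost_grad /stack_x !mxcolK -addrA.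
congr (_ + _); rewrite -mulmxDr; congr (_ *m _).
by rewrite (alpha_split s i).1 addrC.
Qed.

Lemma st_lambda_step gamma s i :
  st_lambda (step gamma s) i = st_lambda s i + gamma *: dual_drift s i.
Proof.
rewrite /=; congr (_ + _ *: _).
have [-> ->] := alpha_split s i; rewrite /dual_drift /dual_field.
rewrite -[dual_error s i]/(st_lambda s i - ls).
move: (avg (dual_error s)) (M *m primal_error s) (node_error s i) => u w d.
by apply/matrixP => k l; rewrite !mxE; ring.
Qed.

Lemma primal_error_step gamma s :
  primal_error (step gamma s) = primal_error s + gamma *: primal_drift s.
Proof.
rewrite /primal_error addrAC; congr (_ - _); apply/mxcolP => i.
by rewrite submxcolD submxcolZ /stack_x !mxcolK st_x_step.
Qed.

Lemma dual_error_step gamma s i :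
  dual_error (step gamma s) i = dual_error s i + gamma *: dual_drift s i.
Proof. by rewrite /dual_error st_lambda_step addrAC. Qed.

Lemma node_input_step gamma s i :
  node_input (step gamma s) i - node_input s i =
  gamma *: col_mx (A i *m submxcol (primal_drift s) i) (dual_drift s i).
Proof.
rewrite /node_input st_x_step st_lambda_step opp_col_mx add_col_mx scale_col_mx.
rewrite mulmxDr -scalemxAr.
by congr col_mx; apply/matrixP => k l; rewrite !mxE; ring.
Qed.

Lemma st_z_step gamma s i j : e i j ->
  st_z (step gamma s) i j = st_z s i j - beta *: node_residual s i j.
Proof.
move=> eij; rewrite /= /neighbors inE eij alpha_hatE /node_residual /residual.
by apply/matrixP => k l; rewrite !mxE; ring.
Qed.

Lemma node_error_bound : exists2 C, 0 < C & forall s,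
  sq (\mxcol_i ((A i)^T *m dsubmx (node_error s i))) <= C * fast_dist s /\
  \sum_i sq (kappa *: dsubmx (node_error s i) + usubmx (node_error s i))
    <= C * fast_dist s.
Proof.
have [C1 C10 HC1] := @tracking_error R N (m + m) e rho e_sym e_conn rho_gt0.
have [|i|C2 C20 HC2] := @uniform_bound R 'I_N 'cV[R]_m
  (fun i v => sq ((A i)^T *m v)) (fun v => sq v).
- exact: sq_ge0.
- exact: sq_mulmx_le.
have NR : 0 <= N%:R :> R := ler0n _ _.
have k2 := sqr_ge0 kappa.
exists (N%:R * ((C2 + 2 * kappa ^+ 2 + 2) * C1) + 1) => [|s].
  have : 0 <= N%:R * ((C2 + 2 * kappa ^+ 2 + 2) * C1); last by lra.
  by apply: mulr_ge0 => //; apply: mulr_ge0; [lra|exact: ltW].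
set X := fast_dist s; have X0 : 0 <= X := energy_ge0 _ _.
have splitE i : sq (usubmx (node_error s i)) + sq (dsubmx (node_error s i))
    <= C1 * X.
  by rewrite -sq_col_mx vsubmxK /node_error alpha_hatE; apply: HC1.
have bound (F : 'I_N -> R) :
    (forall i, F i <= (C2 + 2 * kappa ^+ 2 + 2) * (C1 * X)) ->
    \sum_i F i <= (N%:R * ((C2 + 2 * kappa ^+ 2 + 2) * C1) + 1) * X.
  move=> HF.
  apply: (@le_trans _ _
    (\sum_(i < N) (C2 + 2 * kappa ^+ 2 + 2) * (C1 * X))).
    by apply: ler_sum => i _.
  by rewrite sumr_const card_ord -[X in X <= _]mulr_natl; lra.
have CX0 : 0 <= C1 * X by rewrite mulr_ge0 // ltW.
have kX0 : 0 <= kappa ^+ 2 * (C1 * X) by rewrite mulr_ge0.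
have C2X0 : 0 <= C2 * (C1 * X) by rewrite mulr_ge0 // ltW.
split; first rewrite dot_mxcol.
  apply: bound => i; have := HC2 (dsubmx (node_error s i)) i.
  have := splitE i; have := sq_ge0 (usubmx (node_error s i)) => h1 h2.
  have : C2 * sq (dsubmx (node_error s i)) <= C2 * (C1 * X).
    by rewrite ler_pM2l //; lra.
  lra.
apply: bound => i; apply: le_trans (sqD_le _ _) _; rewrite sqZ.
have := splitE i; have h1 := sq_ge0 (usubmx (node_error s i)).
have h2 := sq_ge0 (dsubmx (node_error s i)) => h.
have : kappa ^+ 2 * sq (dsubmx (node_error s i)) <= kappa ^+ 2 * (C1 * X).
  by rewrite ler_wpM2l //; lra.
lra.
Qed.

Lemma drift_bound : exists2 C, 0 < C & forall s,
  slow_energy (primal_drift s) (dual_drift s)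
    <= C * (slow_dist s + fast_dist s).
Proof.
have [C1 C10 HC1] := node_error_bound.
have [C2 C20 HC2] := @slow_rate_bound R N m _ M c kappa.
exists (C2 * (1 + C1)) => [|s]; first by rewrite mulr_gt0 //; lra.
have [h1 h2] := HC1 s.
have := HC2 (primal_error s) (dual_error s) (gradF (stack_x s) - gradF xs)
  _ _ _ (cost_grad_lipschitz f_smooth _ _) h1 h2.
rewrite -/(slow_dist s) => /le_trans -> //.
rewrite -mulrA ler_pM2l //.
have X0 : 0 <= fast_dist s := energy_ge0 _ _.
have := mulr_ge0 (ltW C10) (slow_energy_ge0 (primal_error s) (dual_error s)).
rewrite -/(slow_dist s); lra.
Qed.

(** The node inputs move by [gamma] times the drift, so [fast_step] is perturbed only by
    [gamma ^+ 2] times the drift energy. *)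
Lemma fast_dist_step : exists2 q, 0 < q & exists2 C, 0 < C & forall gamma s,
  fast_dist (step gamma s) <=
  (1 - q) * fast_dist s + gamma ^+ 2 * C * (slow_dist s + fast_dist s).
Proof.
have [q q0 [C1 C10 HC1]] :=
  @fast_step R N (m + m) e rho e_sym e_conn rho_gt0 beta beta01.
have [C2 C20 HC2] := drift_bound.
have [|i|C3 C30 HC3] := @uniform_bound R 'I_N 'cV[R]_(\sum_i n i)
  (fun i h => sq (A i *m submxcol h i)) (fun h => sq h).
- exact: sq_ge0.
- have [C C0 HC] := sq_mulmx_le (A i); exists C => // h.
  by apply: le_trans (HC _) _; rewrite ler_pM2l // sq_submxcol_le.
have NR : 0 <= N%:R :> R := ler0n _ _.
have NC : 0 <= N%:R * C3 by rewrite mulr_ge0 // ltW.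
exists q => //; exists (C1 * ((N%:R * C3 + 1) * C2)) => [|gamma s].
  by rewrite !mulr_gt0 //; lra.
apply: le_trans (HC1 _ _ _ _ (@st_z_step gamma s)) _.
rewrite -/(node_residual s) -/(fast_dist s) lerD2l.
under eq_bigr do rewrite node_input_step sqZ sq_col_mx.
rewrite -mulr_sumr big_split /=.
have h1 : \sum_i sq (A i *m submxcol (primal_drift s) i) <=
   N%:R * C3 * sq (primal_drift s).
  apply: (@le_trans _ _ (\sum_(i < N) C3 * sq (primal_drift s))).
    by apply: ler_sum => i _; apply: HC3.
  by rewrite sumr_const card_ord -[X in X <= _]mulr_natl mulrA.
have h2 : \sum_i sq (A i *m submxcol (primal_drift s) i)
    + \sum_i sq (dual_drift s i) <=
   (N%:R * C3 + 1) * slow_energy (primal_drift s) (dual_drift s).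
  have := mulr_ge0 NC (sumsq_ge0 (dual_drift s)).
  have := sq_ge0 (primal_drift s).
  rewrite /slow_energy; lra.
have h3 : (N%:R * C3 + 1) * slow_energy (primal_drift s) (dual_drift s) <=
   (N%:R * C3 + 1) * (C2 * (slow_dist s + fast_dist s)).
  by rewrite ler_wpM2l //; lra.
have := ler_wpM2l (mulr_ge0 (ltW C10) (sqr_ge0 gamma)) (le_trans h2 h3).
lra.
Qed.

(* The slow part loses order gamma of its own energy per step, the fast part a
   fixed fraction; all couplings are of order gamma times the fast energy or
   gamma^2, hence are absorbed for small gamma. *)
Lemma energy_decay : exists Phi : state R m n -> R,
  (forall s, slow_dist s <= 2 * Phi s) /\
  exists2 gamma_bar, 0 < gamma_bar & forall gamma, 0 < gamma < gamma_bar ->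
  exists2 sigma, 0 < sigma &
  forall s, Phi (step gamma s) <= (1 - sigma) * Phi s.
Proof.
have [eps eps0 [k k0 [C1 C10 [HV HB]]]] :=
  @lyapunov_slope_bound R N m _ M mu c kappa mu_gt0 kappa_gt0 A_rank.
have [C2 C20 HC2] := node_error_bound; have [C3 C30 HC3] := drift_bound.
have [q q0 [C4 C40 HC4]] := fast_dist_step.
pose V s := lyapunov M eps (primal_error s) (dual_error s).
exists (fun s => V s + fast_dist s); split=> [s|].
  have /andP[h _] := HV (primal_error s) (dual_error s).
  have : 0 <= fast_dist s := energy_ge0 _ _.
  by move: h; rewrite -/(slow_dist s) -/(V s); lra.
(* [a1] is the first-order coupling through the tracking error; [a2] collects the [gamma ^+ 2]
   terms, [2 * C3] from the Euler step and [C4] from the fast part. *)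
pose a1 := 2 * C1 * C2; pose a2 := 2 * C3 + C4.
have a10 : 0 < a1 by rewrite !mulr_gt0.
have a20 : 0 < a2 by rewrite addr_gt0 // mulr_gt0.
(* The bound 1 lowers [gamma ^+ 2] to [gamma] on the fast energy; the other two keep half of the
   slow decay [2 * gamma * k] and half of the fast decay [q]. *)
have [|gb gb0 gb_le] := @pos_below R [:: 1; k / a2; q / 2 / (a1 + a2)].
  by rewrite /= ltr01 !divr_gt0 // addr_gt0.
exists gb => // gamma /andP[g0 g_lt].
have g1 : gamma <= 1.
  by apply: le_trans (ltW g_lt) _; apply: gb_le; rewrite !inE eqxx.
have g2 : gamma * a2 <= k.
  rewrite -ler_pdivlMr; last exact: a20.
  apply: le_trans (ltW g_lt) _.
  by apply: gb_le; rewrite !inE eqxx orbT.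
have g3 : gamma * (a1 + a2) <= q / 2.
  rewrite -ler_pdivlMr; last exact: addr_gt0.
  apply: le_trans (ltW g_lt) _.
  by apply: gb_le; rewrite !inE eqxx !orbT.
(* The slow rate is halved because [V] may be as large as [2 * slow_dist]. *)
have [|sg sg0 sg_le] := @pos_below R [:: gamma * k / 2; q / 2].
  by rewrite /= !divr_gt0 // mulr_gt0.
have s1 : sg <= gamma * k / 2 by apply: sg_le; rewrite !inE eqxx.
have s2 : sg <= q / 2 by apply: sg_le; rewrite !inE eqxx orbT.
exists sg => // s.
have Vstep : V (step gamma s) = V s + 2 * gamma *
    lyapunov_slope M eps (primal_error s) (dual_error s)
      (primal_drift s) (dual_drift s)
    + gamma ^+ 2 * lyapunov M eps (primal_drift s) (dual_drift s).
  rewrite -lyapunovD /V primal_error_step; congr lyapunov.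
  by apply/funext => i; apply: dual_error_step.
have [h1 h2] := HC2 s.
have hB := HB (primal_error s) (dual_error s) _ _ _ _
  (cost_grad_monotone f_diff f_sconvex (stack_x s) xs)
  (cost_grad_lipschitz f_smooth _ _) h1 h2.
rewrite -/(primal_drift s) -/(dual_drift s) -/(slow_dist s) in hB.
have /andP[_ hV] := HV (primal_drift s) (dual_drift s).
have /andP[_ hV2] := HV (primal_error s) (dual_error s).
rewrite -/(slow_dist s) -/(V s) in hV2.
have hD := HC3 s; have hF := HC4 gamma s.
have X0 : 0 <= fast_dist s := energy_ge0 _ _.
have U0 : 0 <= slow_dist s := slow_energy_ge0 _ _.
have gg0 := sqr_ge0 gamma.
have {}hB := ler_wpM2l (_ : 0 <= 2 * gamma) hB.
have {}hB := hB ltac:(lra).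
have hD2 : gamma ^+ 2 * lyapunov M eps (primal_drift s) (dual_drift s) <=
  gamma ^+ 2 * (2 * (C3 * (slow_dist s + fast_dist s))).
  by rewrite ler_wpM2l //; lra.
rewrite Vstep.
have total : V s + 2 * gamma * lyapunov_slope M eps (primal_error s)
    (dual_error s) (primal_drift s) (dual_drift s)
   + gamma ^+ 2 * lyapunov M eps (primal_drift s) (dual_drift s)
   + fast_dist (step gamma s) <=
   V s + fast_dist s - 2 * gamma * k * slow_dist s - q * fast_dist s
   + gamma * a1 * fast_dist s
   + gamma ^+ 2 * a2 * (slow_dist s + fast_dist s).
  by rewrite /a1 /a2; lra.
apply: le_trans total _.
have p1 := ler_wpM2r U0 (ler_wpM2l (ltW g0) g2).
have p2 := ler_wpM2r X0 g3.
have p3 : gamma ^+ 2 * a2 * fast_dist s <= gamma * a2 * fast_dist s.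
  apply: ler_wpM2r => //; apply: ler_wpM2r; first exact: ltW.
  by rewrite expr2 ler_piMr // ltW.
have p4 := ler_wpM2r U0 s1; have p5 := ler_wpM2r X0 s2.
have p6 : sg * (V s + fast_dist s) <= sg * (2 * slow_dist s + fast_dist s).
  by rewrite ler_pM2l //; lra.
rewrite expr2 in p3 *; lra.
Qed.

Lemma exponential_convergence : exists2 gamma_bar, 0 < gamma_bar &
  forall gamma, 0 < gamma < gamma_bar -> forall s0,
  exists a1 a2, [/\ 0 < a1, 0 < a2 & forall t,
    let s := run e f A bs kappa rho beta gamma s0 t in
    enorm (col_mx (stack_x s - xs) (stack_lambda s - ones_kron N m *m ls))
      <= a1 * expR (- a2 * t%:R)].
Proof.
have [Phi [Phi_ge [gb gb0 H]]] := energy_decay.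
exists gb => // gamma /H[sg sg0 step_le] s0.
have Phi0 s : 0 <= Phi s.
  have := le_trans (slow_energy_ge0 _ _) (Phi_ge s); lra.
(* Uses [1 - sg <= expR (- sg)], valid also when [1 - sg] is negative. *)
have decay t : Phi (run e f A bs kappa rho beta gamma s0 t)
    <= expR (- sg * t%:R) * Phi s0.
  elim: t => [|t IH]; first by rewrite mulr0 expR0 mul1r.
  apply: le_trans (step_le _) _; rewrite -natr1 mulrDr mulr1 expRD.
  have h1 := ler_wpM2r (Phi0 (run e f A bs kappa rho beta gamma s0 t))
               (expR_ge1Dx (- sg)).
  have h2 := ler_wpM2l (expR_ge0 (- sg)) IH.
  by rewrite /run in h1 h2 *; lra.
(* The square of this constant dominates [2 * Phi s0], and it is positive even when [Phi s0 = 0];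
   the rate is halved because [Phi] bounds a squared norm. *)
exists (1 + 2 * Phi s0), (sg / 2).
split; [by have := Phi0 s0; lra|by rewrite divr_gt0|move=> t].
cbv zeta; set s := run _ _ _ _ _ _ _ _ _ _.
have -> : stack_lambda s - ones_kron N m *m ls = \mxcol_i dual_error s i.
  rewrite /stack_lambda /ones_kron mxcol_mul -mxcolB.
  by apply: eq_mxcol => i; rewrite mul1mx.
rewrite -(@ler_pXn2r _ 2) ?nnegrE ?sqrtr_ge0 //; last first.
  by apply: mulr_ge0; [have := Phi0 s0; lra|exact: expR_ge0].
rewrite enorm_sqr sq_col_mx dot_mxcol -/(primal_error s).
rewrite -[X in X <= _]/(slow_dist s) exprMn -expRM_natr.
have -> : - (sg / 2) * t%:R * 2 = - sg * t%:R by field.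
apply: le_trans (Phi_ge s) _.
apply: (@le_trans _ _ (2 * (expR (- sg * t%:R) * Phi s0))).
  by rewrite ler_pM2l //; exact: decay.
have p : 2 * Phi s0 <= (1 + 2 * Phi s0) ^+ 2.
  have := Phi0 s0; have := sqr_ge0 (Phi s0).
  rewrite !expr2; lra.
have := ler_wpM2r (expR_ge0 (- sg * t%:R)) p.
lra.
Qed.

End Algorithm.

Theorem theorem1 (R : realType) (N m : nat) (n : 'I_N -> nat)
    (e : rel 'I_N) (e_sym : symmetric e) (e_conn : forall i j, connect e i j)
    (f : forall i : 'I_N, 'cV[R]_(n i) -> R)
    (A : forall i : 'I_N, 'M[R]_(m, n i))
    (b : 'cV[R]_m) (bs : 'I_N -> 'cV[R]_m) (bs_sum : \sum_i bs i = b)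
    (f_sconvex : exists2 mu : R, 0 < mu & strongly_convex mu (total_cost f))
    (f_smooth : exists2 c : R, 0 < c &
       forall i, (forall x, differentiable (f i) x) /\
                 elipschitz c (grad (f i)))
    (A_rank : \rank (\mxrow_i A i) = m) :
  (exists! p : 'cV[R]_(\sum_i n i) * 'cV[R]_m, saddle_point f A b p.1 p.2) /\
  forall (xs : 'cV[R]_(\sum_i n i)) (ls : 'cV[R]_m),
    saddle_point f A b xs ls ->
  forall kappa rho beta : R, 0 < kappa -> 0 < rho -> 0 < beta < 1 ->
  exists2 gamma_bar : R, 0 < gamma_bar &
  forall gamma : R, 0 < gamma < gamma_bar ->
  forall s0 : state R m n,
  exists a1 a2 : R, [/\ 0 < a1, 0 < a2 &
    forall t : nat,
      let s := run e f A bs kappa rho beta gamma s0 t in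
      enorm (col_mx (stack_x s - xs)
                    (stack_lambda s - ones_kron N m *m ls))
        <= a1 * expR (- a2 * t%:R)].
Proof.
have [mu mu0 sconv] := f_sconvex; have [c c0 smooth] := f_smooth.
have fdiff i x : differentiable (f i) x by case: (smooth i).
have fsmooth i : elipschitz c (grad (f i)) by case: (smooth i).
split=> [|xs ls /(saddle_pointP A b fdiff mu0 sconv) opt
          kappa rho beta k0 r0 b01].
  have [x [l xl]] := kkt_exists b fdiff mu0 sconv fsmooth A_rank.
  exists (x, l); split; first exact/(saddle_pointP A b fdiff mu0 sconv).
  move=> [x' l'] /(saddle_pointP A b fdiff mu0 sconv).
  exact: (kkt_unique fdiff mu0 sconv A_rank xl).
exact: (exponential_convergence e_sym e_conn bs_sum fdiff mu0 sconv fsmooth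
  A_rank opt k0 r0 b01).
Qed.
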